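(* Let $n\ge3$, let $\Omega\subset\mathbb{R}^n$ be a bounded domain with $0\in\Omega$, let $k\ge1$ be an integer, and let $\rho=\big(\sup_{x\in\Omega}|x|\big)\, e^{e^{\cdot^{\cdot^{\cdot^{e}}}}}$, where the exponential tower contains $e$ exactly $k$ times. Then for all $1\le m\le k$, $$\frac14=\inf_{u\in H^1_0(\Omega)\setminus\{0\}}\ \frac{\displaystyle\int_{\Omega}|\nabla u|^{2}dx-\Big(\frac{n-2}{2}\Big)^{2}\int_{\Omega}\frac{|u|^{2}}{|x|^{2}}dx-\frac14\sum_{j=1}^{m-1}\int_{\Omega}\frac{|u|^{2}}{|x|^{2}}\Big(\prod_{i=1}^{j}\log^{(i)}\frac{\rho}{|x|}\Big)^{-2}dx}{\displaystyle\int_{\Omega}\frac{|u|^{2}}{|x|^{2}}\Big(\prod_{i=1}^{m}\log^{(i)}\frac{\rho}{|x|}\Big)^{-2}dx}.$$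
   Context: Iterated logarithms: $\log^{(1)}(t)=\log t$ and $\log^{(i)}(t)=\log(\log^{(i-1)}(t))$ for $i\ge2$. An empty sum is $0$. *)

(* Defs.v *)
From HB Require Import structures.
From mathcomp Require Import all_boot all_order all_algebra.
From mathcomp Require Import all_classical all_reals all_analysis.

Set Implicit Arguments.
Unset Strict Implicit.
Unset Printing Implicit Defensive.

Import Order.TTheory GRing.Theory Num.Theory.
Import numFieldNormedType.Exports.

Local Open Scope classical_set_scope.
Local Open Scope ring_scope.

(* Product sigma-algebra on R^n, i.e. the Borel one. *)
Definition measure_rV_display : measure_display -> measure_display.
Proof. exact. Qed.

Section measurable_rV.
Context {R : realType} {n : nat}.

Let coors : 'I_n -> 'rV[R]_n -> measurableTypeR R := fun i x => x 0 i.

Let rV_set0 : g_sigma_preimage coors set0.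
Proof. exact: sigma_algebra0. Qed.

Let rV_setC A : g_sigma_preimage coors A -> g_sigma_preimage coors (~` A).
Proof. exact: sigma_algebraC. Qed.

Let rV_bigcup (F : (set _)^nat) : (forall i, g_sigma_preimage coors (F i)) ->
  g_sigma_preimage coors (\bigcup_i (F i)).
Proof. exact: sigma_algebra_bigcup. Qed.

HB.instance Definition _ := @isMeasurable.Build
  (measure_rV_display (R.-ocitv.-measurable).-sigma%mdisp) 'rV[R]_n
  (g_sigma_preimage coors) rV_set0 rV_setC rV_bigcup.

Lemma measurable_coord (i : 'I_n) :
  measurable_fun [set: 'rV[R]_n] (fun x => x 0 i : measurableTypeR R).
Proof.
move=> _ Y mY; rewrite setTI; apply: sub_sigma_algebra => /=.
rewrite -bigcup_seq/=; exists i => /=; first by rewrite mem_index_enum.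
by exists Y => //; rewrite setTI.
Qed.

Lemma measurable_rVP d (T : measurableType d) (f : T -> 'rV[R]_n) :
  (forall i, measurable_fun [set: T] (fun x => f x 0 i : measurableTypeR R)) ->
  measurable_fun [set: T] f.
Proof.
move=> mf; apply: measurability => //.
move=> _ [B + <-]; rewrite -bigcup_seq => -[i _ [A mA <-]].
by rewrite setTI; exact: mf.
Qed.

End measurable_rV.

Section lebesgue_rV.
Context {R : realType}.

Definition cons_rV n (p : measurableTypeR R * 'rV[R]_n) : 'rV[R]_n.+1 :=
  \row_i oapp (p.2 0) (p.1 : R) (unlift ord0 i).

Lemma cons_rV0 n (p : measurableTypeR R * 'rV[R]_n) : cons_rV p 0 0 = p.1.
Proof. by rewrite mxE unlift_none. Qed.

Lemma cons_rVS n (p : measurableTypeR R * 'rV[R]_n) (i : 'I_n) :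
  cons_rV p 0 (lift ord0 i) = p.2 0 i.
Proof. by rewrite mxE liftK. Qed.

Lemma measurable_cons_rV n : measurable_fun setT (@cons_rV n).
Proof.
apply: measurable_rVP => i; case: (unliftP ord0 i) => [j ->|->].
  rewrite (_ : (fun x => _) =
      (fun x : 'rV[R]_n => x 0 j : measurableTypeR R) \o snd).
    by apply: measurableT_comp => //; exact: measurable_coord.
  by apply/funext => p; exact: cons_rVS.
rewrite (_ : (fun x => _) = fst) //.
by apply/funext => p; exact: cons_rV0.
Qed.

Definition uncons_rV n (x : 'rV[R]_n.+1) : measurableTypeR R * 'rV[R]_n :=
  (x 0 0, \row_i x 0 (lift ord0 i)).

Lemma measurable_uncons_rV n : measurable_fun setT (@uncons_rV n).
Proof.
apply: measurable_fun_pair; first exact: measurable_coord.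
apply: measurable_rVP => i.
rewrite (_ : (fun x => _) =
    fun x : 'rV[R]_n.+1 => x 0 (lift ord0 i) : measurableTypeR R).
  exact: measurable_coord.
by apply/funext => x; rewrite mxE.
Qed.

Lemma cons_rVK n : cancel (@cons_rV n) (@uncons_rV n).
Proof.
move=> p; rewrite /uncons_rV cons_rV0; case: p => a v; congr pair => /=.
by apply/rowP => i; rewrite mxE cons_rVS.
Qed.

Lemma uncons_rVK n : cancel (@uncons_rV n) (@cons_rV n).
Proof.
move=> x; apply/rowP => i; case: (unliftP ord0 i) => [j ->|->].
  by rewrite cons_rVS mxE.
by rewrite cons_rV0.
Qed.

Section lebesgue_rV_step.
Variables (n : nat) (mu : {sigma_finite_measure set 'rV[R]_n -> \bar R}).

Definition lebesgue_rVS : set 'rV[R]_n.+1 -> \bar R :=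
  pushforward (@lebesgue_measure R \x mu)%E (@cons_rV n).

Let lebesgue_rVS0 : lebesgue_rVS set0 = 0%E.
Proof. by rewrite /lebesgue_rVS /pushforward preimage_set0 measure0. Qed.

Let lebesgue_rVS_ge0 A : (0 <= lebesgue_rVS A)%E.
Proof. exact: (@measure_ge0 _ _ _ (@lebesgue_measure R \x mu)%E). Qed.

Let lebesgue_rVS_sigma_additive : semi_sigma_additive lebesgue_rVS.
Proof.
have mpre A : measurable A -> measurable (@cons_rV n @^-1` A).
  by move=> mA; rewrite -[X in measurable X]setTI; exact: measurable_cons_rV.
move=> F mF tF mUF; rewrite /lebesgue_rVS /pushforward preimage_bigcup.
apply: measure_semi_sigma_additive => [k||].
- exact: mpre.
- by move=> i j _ _ [x [Fi Fj]]; apply: tF => //; exists (cons_rV x).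
- by rewrite -preimage_bigcup; exact: mpre.
Qed.

HB.instance Definition _ := isMeasure.Build _ _ _ lebesgue_rVS
  lebesgue_rVS0 lebesgue_rVS_ge0 lebesgue_rVS_sigma_additive.

Let lebesgue_rVS_sigma_finite : sigma_finite setT lebesgue_rVS.
Proof.
have /sigma_finiteP[F [TF ndF Foo]] := sigma_finiteT (@lebesgue_measure R).
have /sigma_finiteP[G [TG ndG Goo]] := sigma_finiteT mu.
exists (fun k => @uncons_rV n @^-1` (F k `*` G k)) => [|k].
  rewrite -preimage_bigcup; apply/esym; rewrite -subTset => x _ /=.
  have [j _ Fj] : (\bigcup_i F i) (uncons_rV x).1 by rewrite -TF.
  have [l _ Gl] : (\bigcup_i G i) (uncons_rV x).2 by rewrite -TG.
  exists (maxn j l) => //; split => /=.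
  - by move: Fj; exact/subsetPset/ndF/leq_maxl.
  - by move: Gl; exact/subsetPset/ndG/leq_maxr.
have [mF Fk] := Foo k; have [mG Gk] := Goo k.
have mFG : measurable (F k `*` G k) by exact: measurableX.
split; first by rewrite -[X in measurable X]setTI; exact: measurable_uncons_rV.
rewrite /lebesgue_rVS /pushforward -comp_preimage.
rewrite (_ : _ \o _ = id); last by apply/funext => p /=; rewrite cons_rVK.
by rewrite preimage_id product_measure1E// lte_mul_pinfty// ge0_fin_numE.
Qed.

HB.instance Definition _ := @Measure_isSigmaFinite.Build _ _ _ lebesgue_rVS
  lebesgue_rVS_sigma_finite.

End lebesgue_rV_step.

(* Lebesgue measure on R^n, as the n-fold product of the one on R. *)
Fixpoint lebesgue_rV n : {sigma_finite_measure set 'rV[R]_n -> \bar R} :=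
  match n with
  | 0 => \d_(0 : 'rV[R]_0)
  | n'.+1 => lebesgue_rVS (lebesgue_rV n')
  end.

Lemma lebesgue_rV_box n (A : 'I_n -> set (measurableTypeR R)) :
  (forall i, measurable (A i)) ->
  lebesgue_rV n [set x : 'rV[R]_n | forall i, A i (x 0 i)] =
  (\prod_(i < n) lebesgue_measure (A i))%E.
Proof.
elim: n A => [|n IHn] A mA.
  rewrite big_ord0 /= diracE mem_set//= => -[]//.
rewrite big_ord_recl -IHn// -product_measure1E//; last first.
  have -> : [set x : 'rV[R]_n | forall i, A (lift ord0 i) (x 0 i)] =
      \bigcap_(i in [set: 'I_n])
        (fun x : 'rV[R]_n => x 0 i : measurableTypeR R) @^-1` A (lift ord0 i).
    by apply/seteqP; split => x /= H i; [move=> _|]; exact: H.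
  apply: fin_bigcap_measurable => // i _.
  by rewrite -[X in measurable X]setTI; exact: measurable_coord.
rewrite /= /lebesgue_rVS /pushforward; congr (_ _).
apply/seteqP; split => p /=.
  by move=> H; split => [|i]; [rewrite -cons_rV0|rewrite -cons_rVS].
by move=> [H1 H2] i; case: (unliftP ord0 i) => [j|] ->; rewrite ?cons_rV0 ?cons_rVS.
Qed.

End lebesgue_rV.

Section sobolev.
Context {R : realType} {n : nat}.
Implicit Types (W : set 'rV[R]_n) (u phi : 'rV[R]_n -> R)
  (g : 'rV[R]_n -> 'rV[R]_n).

(* The library norm on 'rV[R]_n is the sup norm. *)
Definition enorm (x : 'rV[R]_n) : R := Num.sqrt (\sum_i x 0 i ^+ 2).

Definition partial (i : 'I_n) phi : 'rV[R]_n -> R :=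
  fun x => 'D_(delta_mx 0 i) phi x.

Definition gradient phi : 'rV[R]_n -> 'rV[R]_n :=
  fun x => \row_i partial i phi x.

Definition smooth phi : Prop := forall s : seq 'I_n,
  let f := foldr partial phi s in
  continuous f /\ forall i x, derivable f x (delta_mx 0 i).

(* C_c^oo(W) *)
Definition test_function W phi : Prop :=
  [/\ smooth phi, compact (closure [set x | phi x != 0])
    & closure [set x | phi x != 0] `<=` W].

Definition L2 W u : Prop := measurable_fun W u /\
  (\int[lebesgue_rV n]_(x in W) (u x ^+ 2)%:E < +oo)%E.

Definition weak_gradient W u g : Prop :=
  forall (i : 'I_n) phi, test_function W phi ->
    (\int[lebesgue_rV n]_(x in W) (u x * partial i phi x)%:E =
     - \int[lebesgue_rV n]_(x in W) (g x 0 i * phi x)%:E)%E.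

(* [sobolevH1 W u g]: u is in H^1(W) and its weak gradient is g; g is unique
   up to a null set. *)
Definition sobolevH1 W u g : Prop :=
  [/\ L2 W u, forall i, L2 W (fun x => g x 0 i) & weak_gradient W u g].

(* [sobolevH10 W u g]: u is moreover in H^1_0(W), the closure of C_c^oo(W) for
   the H^1 norm. *)
Definition sobolevH10 W u g : Prop := sobolevH1 W u g /\
  forall e : R, 0 < e -> exists2 phi, test_function W phi &
    (\int[lebesgue_rV n]_(x in W) ((u x - phi x) ^+ 2)%:E +
     \int[lebesgue_rV n]_(x in W) (enorm (g x - gradient phi x) ^+ 2)%:E
       < (e ^+ 2)%:E)%E.

End sobolev.

Section iterated_log.
Context {R : realType}.

(* iterlog 1 t = log t *)
Definition iterlog (i : nat) (t : R) : R := iter i (@ln R) t.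

(* exp_tower k is the tower e^e^...^e in which e occurs k times. *)
Definition exp_tower (k : nat) : R := iter k expR 1.

End iterated_log.

Section hardy.
Context {R : realType} {n : nat}.
Implicit Types (W : set 'rV[R]_n) (u : 'rV[R]_n -> R)
  (g : 'rV[R]_n -> 'rV[R]_n).

(* \int_W |u|^2 / |x|^2 (\prod_(i = 1)^j log^(i) (rho / |x|))^-2 dx;
   the origin, where x / 0 = 0, is a null set. *)
Definition log_hardy W (rho : R) (j : nat) u : \bar R :=
  (\int[lebesgue_rV n]_(x in W)
     (u x ^+ 2 / enorm x ^+ 2 *
      (\prod_(1 <= i < j.+1) iterlog i (rho / enorm x)) ^- 2)%:E)%E.

Definition hardy_quotient W (rho : R) (m : nat) u g : \bar R :=
  ((\int[lebesgue_rV n]_(x in W) (enorm (g x) ^+ 2)%:E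
    - (((n%:R - 2) / 2) ^+ 2)%:E *
      \int[lebesgue_rV n]_(x in W) (u x ^+ 2 / enorm x ^+ 2)%:E
    - (4^-1)%:E * \sum_(1 <= j < m) log_hardy W rho j u)
   / log_hardy W rho m u)%E.

End hardy.

(* Main.v *)
Require Import Defs.
From mathcomp Require Import all_boot all_order all_algebra.
From mathcomp Require Import all_classical all_reals all_analysis.
From mathcomp Require Import measurable_realfun ring lra.

Set Implicit Arguments.
Unset Strict Implicit.
Unset Printing Implicit Defensive.

Import Order.TTheory GRing.Theory Num.Theory.
Import numFieldNormedType.Exports.

Local Open Scope classical_set_scope.
Local Open Scope ring_scope.

(** With [L i] the i-th iterated logarithm of [rho / |x|] and
    [P j = L 1 * ... * L j], the positive supersolution behind the inequality is
    [w = |x|^(-(n-2)/2) (P m)^(1/2)]. For the lower bound, expand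
    [0 <= |grad phi + phi F|^2] with [F = - grad w / w] and integrate by parts.
    Evaluating the radial profile of [F] at [|x|^2 + e^2] removes the singularity
    at the origin; with the potential truncated the inequality passes to
    [H^1_0] by density, and then [e] tends to 0 by Fatou's lemma.
    For the sharpness of 1/4, the trial functions are [u = w * b (delta L (m+1) - 1)]
    with [b] a smooth bump such that [- b'' <= 32 b]: they satisfy
    [- Laplacian u <= (V + 32 delta^2 / (|x| P m)^2) u] pointwise, where [V] is the
    potential of the improved Hardy inequality, so that the quotient is at most
    [1/4 + 32 delta^2]. *)

(** * Integration by parts for Lebesgue measure on R^n *)

Section measure_rV.
Context {R : realType}.

(** The field [F] satisfies the Riccati identity div F - |F|^2 = V exactly. Test functions need not
    vanish at the origin, where [F] blows up, so the integration by parts needs a field that is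
    regular there; the shift of |x|^2 provides it, and its error has the right sign because the
    shift goes upwards. The potential is truncated because closeness in H^1 controls a weighted L^2
    norm only when the weight is bounded. For the sharpness, L (m+1) is the natural variable: on w *
    v(L (m+1)) the operator - Laplacian - V acts as - v'' w / (|x| P m)^2, so the question is
    whether - v'' has a positive spectral bound on a half-line. It has none, as one sees by
    stretching a fixed profile to length 1/delta. A sine arch would not be smooth when extended by
    zero; with the bump, [u] itself lies in C_c^oo and its support avoids the origin. The constant
    32 is the largest value of - b''/b, reached at the midpoint of the bump. The pointwise
    inequality is then integrated against [u], so that no integral has to be evaluated. *)

Lemma measurable_rV_box n (A : 'I_n -> set (measurableTypeR R)) :
  (forall i, measurable (A i)) ->
  measurable [set x : 'rV[R]_n | forall i, A i (x 0 i)].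
Proof.
move=> mA.
have -> : [set x : 'rV[R]_n | forall i, A i (x 0 i)] =
    \bigcap_(i in [set: 'I_n])
      (fun x : 'rV[R]_n => x 0 i : measurableTypeR R) @^-1` A i.
  by apply/seteqP; split => x /= H i; [move=> _|]; exact: H.
apply: fin_bigcap_measurable => // i _.
by rewrite -[X in measurable X]setTI; exact: measurable_coord.
Qed.

Lemma mx_norm_ltP n (x : 'rV[R]_n) (e : R) : 0 < e ->
  reflect (forall i, `|x 0 i| < e) (`|x| < e).
Proof.
move=> e0; have -> : `|x| = mx_norm x by [].
rewrite mx_normrE; apply: (iffP idP) => [/bigmax_ltP[_ H] i|H].
  exact: (H (0, i)).
by apply/bigmax_ltP; split=> // -[a b] _ /=; rewrite ord1; exact: H.
Qed.

(** The sigma-algebra is generated by the coordinates, so an open set is written as a countable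
    union of boxes: those with rational centre and half-width 1/(p+1) that it contains. *)
Lemma open_measurable_rV n (U : set 'rV[R]_n) : open U -> measurable U.
Proof.
move=> oU.
pose A (p : 'rV[rat]_n * nat) (i : 'I_n) : set (measurableTypeR R) :=
  [set` `](ratr (p.1 0 i) - p.2.+1%:R^-1), (ratr (p.1 0 i) + p.2.+1%:R^-1)[ ].
pose B p := [set x : 'rV[R]_n | forall i, A p i (x 0 i)].
have AP p i t : A p i t <-> `|ratr (p.1 0 i) - t| < p.2.+1%:R^-1.
  by rewrite /A/= in_itv/= ltr_distlC.
have mB p : measurable (B p).
  by apply: (@measurable_rV_box n (A p)) => i; exact: measurable_itv.
pose J := [set p | B p `<=` U].
have -> : U = \bigcup_(p in J) B p; last first.
  rewrite bigcup_mkcond; apply: countable_bigcupT_measurable => [|p].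
    exact: countableP.
  by case: ifP.
apply/seteqP; split => [x Ux|x [p Jp Bx]]; last exact: Jp.
have /nbhs_ballP[e /= e0 eU] := oU _ Ux.
(* Balls are cubes for the sup norm. A centre within 1/(k+1) of [x] and a half-width 1/(k+1), both
   below e/2, keep the box inside the ball of radius [e] around [x]. *)
have e20 : 0 < e / 2 by rewrite divr_gt0.
have [k _ /(_ k (leqnn k)) /= ke] := near_infty_natSinv_lt (PosNum e20).
have hk : 0 < k.+1%:R^-1 :> R by rewrite invr_gt0 ltr0Sn.
have H i : exists q : rat, `|x 0 i - ratr q| < k.+1%:R^-1.
  have : x 0 i - k.+1%:R^-1 < x 0 i + k.+1%:R^-1.
    by rewrite ltrBlDr -addrA ltrDl addr_gt0.
  move=> /rat_in_itvoo[q]; rewrite in_itv/= => /andP[q1 q2]; exists q.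
  by rewrite ltr_distlC q1 q2.
have [q qP] := choice H.
exists (\row_i q i, k) => /=; last by move=> i; apply/AP; rewrite mxE distrC.
move=> y By; apply: eU; rewrite -ball_normE /ball_/=; apply/mx_norm_ltP => // i.
have /AP := By i; rewrite /= mxE => yi; rewrite !mxE.
have -> : x 0 i - y 0 i = (x 0 i - ratr (q i)) + (ratr (q i) - y 0 i).
  by rewrite addrA subrK.
rewrite (le_lt_trans (ler_normD _ _))// [ltRHS]splitr.
by rewrite ltrD// (lt_trans _ ke).
Qed.

Lemma open_continuous_measurable_rV n (W : set 'rV[R]_n) (f : 'rV[R]_n -> R) :
  open W -> {in W, continuous f} ->
  measurable_fun W (f : _ -> measurableTypeR R).
Proof.
move=> oW; rewrite -continuous_open_subspace// => /continuousP cf.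
apply: (measurability _ (@RGenOpens.measurableE R)).
move=> _ [_ [a [b ->] <-]]; apply: open_measurable_rV.
have /cf/open_subspaceP[V oV VD] : open (`]a, b[%classic : set R).
  exact: interval_open.
by rewrite setIC -VD; apply: openI.
Qed.

Lemma continuous_measurable_rV n (f : 'rV[R]_n -> R) : continuous f ->
  measurable_fun setT (f : _ -> measurableTypeR R).
Proof.
by move=> cf; apply: open_continuous_measurable_rV => //; exact: openT.
Qed.


Definition upd n (i : 'I_n) (x : 'rV[R]_n) (t : R) : 'rV[R]_n :=
  \row_j if j == i then t else x 0 j.

Lemma upd_cons0 n (t s : R) (y : 'rV[R]_n) :
  upd ord0 (cons_rV (t, y)) s = cons_rV (s, y).
Proof.
apply/rowP => j; rewrite !mxE; case: (unliftP ord0 j) => [k ->|->] //=.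
Qed.

Lemma upd_consS n (i : 'I_n) (t s : R) (y : 'rV[R]_n) :
  upd (lift ord0 i) (cons_rV (t, y)) s = cons_rV (t, upd i y s).
Proof.
apply/rowP => j; rewrite !mxE; case: (unliftP ord0 j) => [k ->|->] //=.
by rewrite mxE (inj_eq lift_inj).
Qed.

(** The support condition is stated coordinate by coordinate so that slices inherit it with the same
    constants, as the induction on the dimension requires. *)
Definition tame n (C M : R) (f : 'rV[R]_n -> R) :=
  [/\ measurable_fun setT (f : _ -> measurableTypeR R), forall x, `|f x| <= C
    & forall (x : 'rV[R]_n) i, M < `|x 0 i| -> f x = 0].

Lemma lebesgue_rV_cube_lty n (M : R) :
  (lebesgue_rV n [set x : 'rV[R]_n | forall i, x 0%R i \in `[(- M)%R, M]%R] < +oo)%E.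
Proof.
have := @lebesgue_rV_box R n (fun=> [set` `[- M, M]]) (fun=> measurable_itv _).
rewrite /= => ->.
suff : (0 <= \prod_(i < n) lebesgue_measure (`[(- M)%R, M] : set R) < +oo)%E.
  by case/andP.
elim/big_ind : _ => [|x y /andP[x0 xoo] /andP[y0 yoo]|_ _].
- by rewrite lee01 ltry.
- by rewrite mule_ge0// lte_mul_pinfty// ge0_fin_numE.
- by rewrite measure_ge0 lebesgue_measure_itv/=; case: ifP => _; rewrite ?ltry.
Qed.

Lemma tame_integrable n C M (f : 'rV[R]_n -> R) : tame C M f ->
  (lebesgue_rV n).-integrable setT (EFin \o f).
Proof.
move=> [mf fC fM].
pose K := [set x : 'rV[R]_n | forall i, x 0 i \in `[- M, M]].
have mK : measurable K.
  by apply: (@measurable_rV_box n (fun=> [set` `[- M, M]])) => i; exact: measurable_itv.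
have -> : EFin \o f = (EFin \o f) \_ K.
  apply/funext => x; rewrite patchE; case: ifPn => //= /negP xK.
  have /existsNP[i /negP] : ~ K x by move=> Kx; apply: xK; rewrite inE.
  rewrite in_itv/= -ler_norml -ltNge => /fM ->//.
apply/(integrable_mkcond _ mK); apply: measurable_bounded_integrable => //.
- exact: lebesgue_rV_cube_lty.
- exact: measurable_funTS.
- exists C; split => [|y Cy x _]; first exact: num_real.
by rewrite /= (le_trans (fC x)) // ltW.
Qed.

Lemma measurable_slice n (f : 'rV[R]_n.+1 -> R) (t : R) :
  measurable_fun setT (f : _ -> measurableTypeR R) ->
  measurable_fun setT (fun y : 'rV[R]_n =>
    f (cons_rV (t : measurableTypeR R, y)) : measurableTypeR R).
Proof.
move=> mf; apply: (measurableT_comp mf).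
apply: (measurableT_comp (@measurable_cons_rV _ _)).
exact: measurable_pair1.
Qed.

Lemma tame_slice n C M (f : 'rV[R]_n.+1 -> R) (t : R) : tame C M f ->
  tame C M (fun y => f (cons_rV (t, y))).
Proof.
move=> [mf fC fM]; split=> // [|x i xi]; first exact: measurable_slice.
by apply: (fM _ (lift ord0 i)); rewrite cons_rVS.
Qed.

Lemma tame_integrable_cons n C M (f : 'rV[R]_n.+1 -> R) : tame C M f ->
  (@lebesgue_measure R \x lebesgue_rV n)%E.-integrable setT
    (fun p => (f (cons_rV p))%:E).
Proof.
move=> tf; have [mf _ _] := tf.
have mfE : measurable_fun setT (EFin \o f) by exact/measurable_EFinP.
have mc := @measurable_cons_rV R n.
apply/integrableP; split; first exact: (measurableT_comp mfE mc).
have /integrableP[_] := tame_integrable tf; apply: le_lt_trans.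
have := @ge0_integral_pushforward _ _ _ _ R _ mc
  (@lebesgue_measure R \x lebesgue_rV n)%E setT (abse \o (EFin \o f)).
rewrite preimage_setT => <- //; first exact: measurableT_comp.
by move=> y _ /=.
Qed.

Lemma integral_lebesgue_rVS n C M (f : 'rV[R]_n.+1 -> R) : tame C M f ->
  (\int[lebesgue_rV n.+1]_x (f x)%:E =
   \int[@lebesgue_measure R \x lebesgue_rV n]_p (f (cons_rV p))%:E)%E.
Proof.
move=> tf; have [mf _ _] := tf.
have mfE : measurable_fun setT (EFin \o f) by exact/measurable_EFinP.
have mc := @measurable_cons_rV R n.
have ic := tame_integrable_cons tf.
have := @integral_pushforward _ _ _ _ R _ mc
  (@lebesgue_measure R \x lebesgue_rV n)%E setT (EFin \o f) mfE.
by rewrite preimage_setT; apply.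
Qed.

(** Fubini and induction on the dimension: the first coordinate is integrated innermost when it is
    coordinate [i], and outermost otherwise, in which case the inner integral vanishes by
    induction. *)
Lemma tame_integral_eq0 n (i : 'I_n) C M (f : 'rV[R]_n -> R) : tame C M f ->
  (forall x, \int[@lebesgue_measure R]_t (f (upd i x t))%:E = 0)%E ->
  (\int[lebesgue_rV n]_x (f x)%:E = 0)%E.
Proof.
elim: n i f => [|n IHn] i f tf f0; first by case: i f0.
have intf := tame_integrable_cons tf.
rewrite (integral_lebesgue_rVS tf).
case: (unliftP ord0 i) f0 => [j ->|->] f0.
  rewrite -integral12_prod_meas1//; apply: integral0_eq => t _.
  apply: (IHn j); first exact: tame_slice.
  by move=> y; under eq_integral do rewrite -upd_consS.
rewrite -integral21_prod_meas1//; apply: integral0_eq => y _.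
by rewrite -(f0 (cons_rV (0, y))); apply: eq_integral => t _; rewrite upd_cons0.
Qed.
End measure_rV.

Section partial_integral.
Context {R : realType}.

Lemma integral_derive_eq0 (F f : R -> R) (M : R) :
  (forall t : R, is_derive t 1 F (f t)) -> continuous f ->
  (forall t, M < `|t| -> F t = 0) -> (forall t, M < `|t| -> f t = 0) ->
  (\int[@lebesgue_measure R]_t (f t)%:E = 0)%E.
Proof.
move=> dF cf F0 f0.
have cF : continuous F.
  by move=> t; apply/differentiable_continuous/derivable1_diffP.
(* Strictly beyond [M], so that [F] vanishes at both endpoints. *)
pose N : R := `|M| + 1.
have MN : M < N by rewrite ltr_pwDr// ler_norm.
have N0 : 0 < N by rewrite ltr_pwDr.
have -> : (\int[@lebesgue_measure R]_t (f t)%:E =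
    \int[@lebesgue_measure R]_(t in `[(- N)%R, N]) (f t)%:E)%E.
  rewrite [RHS]integral_mkcond; apply: eq_integral => t _.
  rewrite patchE; case: ifPn => // /negP tN; rewrite f0//.
  rewrite (lt_trans MN)// ltNge ler_norml; apply/negP => h; apply: tN.
  by rewrite inE/= in_itv.
rewrite (@continuous_FTC2 R f F).
- by rewrite !F0 ?subee// ?normrN ger0_norm// ltW.
- by rewrite gtrN.
- exact: continuous_subspaceT.
- split; first by move=> t _; case: (dF t).
  + by apply: cvg_at_right_filter; exact: cF.
  + by apply: cvg_at_left_filter; exact: cF.
- by move=> t _; rewrite derive1E; case: (dF t).
Qed.

Lemma coord_le_norm n (x : 'rV[R]_n) (i : 'I_n) : `|x 0 i| <= `|x|.
Proof.
rewrite [leRHS](_ : _ = mx_norm x)// mx_normrE.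
exact: (le_bigmax_cond _ (fun ij => `|x ij.1 ij.2|) (j := (0, i))).
Qed.

Lemma upd_linear n (i : 'I_n) (x : 'rV[R]_n) (t : R) :
  upd i x t = t *: delta_mx 0 i + upd i x 0.
Proof.
apply/rowP => j; rewrite !mxE/=; case: eqP => _; last by rewrite mulr0 add0r.
by rewrite mulr1 addr0.
Qed.

Lemma continuous_upd n (i : 'I_n) (x : 'rV[R]_n) : continuous (upd i x).
Proof.
rewrite (_ : upd i x = fun t => t *: delta_mx 0 i + upd i x 0); last first.
  by apply/funext => t; exact: upd_linear.
by move=> t; apply: cvgD; [apply: cvgZr_tmp; exact: cvg_id|exact: cvg_cst].
Qed.

Lemma is_derive_upd n (i : 'I_n) (f : 'rV[R]_n -> R) (x : 'rV[R]_n) (t d : R) :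
  is_derive (upd i x t) (delta_mx 0 i) f d ->
  is_derive t (1 : R) (fun s => f (upd i x s)) d.
Proof.
move=> [df <-].
have E : (fun h => h^-1 *: (((fun s => f (upd i x s)) \o shift t) (h *: (1 : R^o))
    - f (upd i x t))) =
  (fun h => h^-1 *: ((f \o shift (upd i x t)) (h *: delta_mx 0 i) - f (upd i x t))).
  apply/funext => h /=; congr (_ *: (f _ - _)).
  rewrite (_ : h *: (1 : R^o) + t = h + t); last by rewrite [X in X + t]mulr1.
  by rewrite upd_linear [in RHS]upd_linear scalerDl addrA.
by split; [rewrite /derivable E|rewrite /derive E].
Qed.

Lemma is_derive_near0 n (f : 'rV[R]_n -> R) (x v : 'rV[R]_n) d :
  is_derive x v f d -> (\forall y \near x, f y = 0) -> d = 0.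
Proof.
move=> [df <-] f0; rewrite -(derive_cst (0 : R) x v).
have [->|v0] := eqVneq v 0; first by rewrite !derive0.
exact: near_eq_derive.
Qed.

Lemma tame_compact n (f : 'rV[R]_n -> R) (M : R) : continuous f ->
  (forall x, M < `|x| -> f x = 0) -> exists C, tame C M f.
Proof.
move=> cf f0; pose A := [set x : 'rV[R]_n | `|x| <= `|M|].
have [c _ cP] : exists2 c, c \in A & forall t, t \in A -> `|f t| <= `|f c|.
  apply: (@EVT_max_rV _ _ (fun x => `|f x|)).
  - by exists 0; rewrite /A/= normr0.
  - apply: bounded_closed_compact.
    + exists `|M|; split; first exact: num_real.
      by move=> y My x /= xM; rewrite (le_trans xM)// ltW.
    + rewrite (_ : A = (fun x => `|x|) @^-1` [set t | t <= `|M|])//.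
      apply: closed_comp; last exact: closed_le.
      by move=> x _; exact: norm_continuous.
  - apply: continuous_subspaceT => x; apply: continuous_comp; first exact: cf.
    exact: norm_continuous.
exists `|f c|; split.
- exact: continuous_measurable_rV.
- move=> x; have [xM|Mx] := leP `|x| M; last by rewrite f0// normr0.
  by apply: cP; rewrite inE /A/= (le_trans xM)// ler_norm.
- move=> x i Mx; apply: f0; rewrite (lt_le_trans Mx)//.
  exact: coord_le_norm.
Qed.

Lemma integral_partial_eq0 n (i : 'I_n) (psi dpsi : 'rV[R]_n -> R) (M : R) :
  (forall x, is_derive x (delta_mx 0 i) psi (dpsi x)) -> continuous dpsi ->
  (forall x, M < `|x| -> psi x = 0) ->
  (\int[lebesgue_rV n]_x (dpsi x)%:E = 0)%E.
Proof.
move=> dpsiP cd p0.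
have d0 x : M < `|x| -> dpsi x = 0.
  move=> Mx; apply: is_derive_near0 (dpsiP x) _.
  have : \forall y \near x, M < `|y|.
    have oN : open [set t : R | M < t] by exact: open_gt.
    apply: (@norm_continuous R 'rV[R]_n x [set t | M < t]).
    exact: open_nbhs_nbhs.
  by apply: filterS => y; exact: p0.
have [C tC] := tame_compact cd d0.
apply: (tame_integral_eq0 (i := i) tC) => x.
have updE t : `|t| <= `|upd i x t|.
  by apply: le_trans (coord_le_norm _ i); rewrite mxE eqxx.
apply: (@integral_derive_eq0 (fun t => psi (upd i x t)) _ M).
- by move=> t; apply: is_derive_upd.
- move=> t; apply: continuous_comp; last exact: cd.
  exact: continuous_upd.
- by move=> t Mt; apply: p0; rewrite (lt_le_trans Mt)//.
- by move=> t Mt; apply: d0; rewrite (lt_le_trans Mt)//.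
Qed.

End partial_integral.

Lemma near_eq_continuous_at (T U : topologicalType) (f g : T -> U) (x : T) :
  (\forall y \near x, f y = g y) -> {for x, continuous f} ->
  {for x, continuous g}.
Proof.
rewrite /prop_for/continuous_at => fg; rewrite (nbhs_singleton fg).
by apply: cvg_trans; exact: near_eq_cvg.
Qed.

Lemma open_neq {R : realType} {V : normedModType R} (a : V) :
  open [set x | x != a].
Proof.
rewrite (_ : [set x | x != a] = ~` [set a]).
  rewrite openC; apply: accessible_closed_set1; apply: hausdorff_accessible.
  exact: norm_hausdorff.
by apply/seteqP; split => t /= /eqP.
Qed.

Section continuity_rV.
Context {R : realType} {n : nat}.
Implicit Types (f g : 'rV[R]_n -> R) (x : 'rV[R]_n).

Lemma for_continuous_comp f (h : R -> R) x : {for x, continuous f} ->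
  {for f x, continuous h} -> {for x, continuous (fun y => h (f y))}.
Proof. exact: (@continuous_comp 'rV[R]_n R R f h x). Qed.

Lemma for_continuousD f g x : {for x, continuous f} -> {for x, continuous g} ->
  {for x, continuous (fun y => f y + g y)}.
Proof. exact: (@continuousD R R 'rV[R]_n f g x). Qed.

Lemma for_continuousM f g x : {for x, continuous f} -> {for x, continuous g} ->
  {for x, continuous (fun y => f y * g y)}.
Proof. exact: (@continuousM R 'rV[R]_n f g x). Qed.

Lemma for_continuous_sum (I : Type) (r : seq I) (f : I -> 'rV[R]_n -> R) x :
  (forall i, {for x, continuous (f i)}) ->
  {for x, continuous (fun y => \sum_(i <- r) f i y)}.
Proof.
move=> cf; elim: r => [|i r IHr].
  by under [X in {for x, continuous X}]eq_fun do rewrite big_nil; exact: cst_continuous.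
under [X in {for x, continuous X}]eq_fun do rewrite big_cons.
exact: for_continuousD.
Qed.

Lemma for_continuous_coord (i : 'I_n) x : {for x, continuous (fun y : 'rV[R]_n => y 0 i)}.
Proof. exact: coord_continuous. Qed.

Lemma for_continuousX f k x : {for x, continuous f} ->
  {for x, continuous (fun y => f y ^+ k)}.
Proof.
move=> cf; apply: (@for_continuous_comp f (fun t => t ^+ k)) => //.
exact: exprn_continuous.
Qed.

End continuity_rV.

(** * The divergence theorem for compactly supported fields, and test functions *)

Section compact_support.
Context {R : realType} {n : nat}.
Implicit Types (W K : set 'rV[R]_n) (psi dpsi : 'rV[R]_n -> R).

Lemma compact_norm_le K : compact K -> exists M, forall x, K x -> `|x| <= M.
Proof.
move=> /compact_bounded[M [_ /(_ (M + 1))]].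
by rewrite ltrDl ltr01 => /(_ isT) KM; exists (M + 1).
Qed.

(** Since [psi] vanishes off the compact set [K] inside the open set [W], the extension of [dpsi] by
    zero is a continuous partial derivative of [psi] on the whole space, where the previous result
    applies. *)
Lemma integral_partial_compact W K (i : 'I_n) psi dpsi :
  open W -> compact K -> K `<=` W ->
  (forall x, W x -> is_derive x (delta_mx 0 i) psi (dpsi x)) ->
  (forall x, W x -> {for x, continuous dpsi}) ->
  (forall x, ~ K x -> psi x = 0) ->
  (lebesgue_rV n).-integrable W (EFin \o dpsi) /\
  (\int[lebesgue_rV n]_(x in W) (dpsi x)%:E = 0)%E.
Proof.
move=> oW cptK KW dP cd p0.
have clK : closed K by apply: compact_closed => //; exact: norm_hausdorff.
have oK : open (~` K) by rewrite openC.
have pn0 x : ~ K x -> \forall y \near x, psi y = 0.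
  move=> Kx; have : nbhs x (~` K) by exact: open_nbhs_nbhs.
  by apply: filterS => y; exact: p0.
have d0 x : W x -> ~ K x -> dpsi x = 0.
  by move=> Wx Kx; apply: is_derive_near0 (dP x Wx) (pn0 x Kx).
pose d := dpsi \_ W.
have dE x : W x -> d x = dpsi x by move=> Wx; rewrite /d patchE mem_set.
have dN x : ~ K x -> d x = 0.
  move=> Kx; rewrite /d patchE; case: ifPn => //; rewrite inE => Wx; exact: d0.
have dD x : is_derive x (delta_mx 0 i) psi (d x).
  have [Wx|Wx] := pselect (W x); first by rewrite dE//; exact: dP.
  have Kx : ~ K x by move=> /KW.
  rewrite dN//; apply: (@near_eq_is_derive _ _ _ (cst 0)).
  by apply: filterS (pn0 x Kx) => y ->.
have cd' : continuous d.
  move=> x; have [Wx|Wx] := pselect (W x).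
    apply: near_eq_continuous_at (cd x Wx).
    have nW : nbhs x W by exact: open_nbhs_nbhs.
    by apply: filterS nW => y /dE.
  have Kx : ~ K x by move=> /KW.
  apply: (@near_eq_continuous_at _ _ (cst 0)); last exact: cst_continuous.
  have : nbhs x (~` K) by exact: open_nbhs_nbhs.
  by apply: filterS => y Ky; rewrite dN.
have [M KM] := compact_norm_le cptK.
have p0M x : M < `|x| -> psi x = 0.
  by move=> Mx; apply: p0 => /KM; rewrite leNgt Mx.
have mW : measurable W by exact: open_measurable_rV.
have EW : (EFin \o dpsi) \_ W = EFin \o d.
  by apply/funext => x; rewrite /d /= !patchE; case: ifP.
have d0M x : M < `|x| -> d x = 0.
  by move=> Mx; apply: dN => /KM; rewrite leNgt Mx.
have [C tC] := tame_compact cd' d0M.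
split.
  by apply/(integrable_mkcond _ mW); rewrite EW; exact: tame_integrable tC.
by rewrite integral_mkcond EW; apply: integral_partial_eq0 dD cd' p0M.
Qed.

(** The divergence of a compactly supported field integrates to zero, so it may be added to a
    pointwise upper bound. Both halves of the theorem come from this inequality, one with the field
    phi^2 F and the other with u grad u. *)
Lemma le_integral_div W K (Y dY : 'I_n -> 'rV[R]_n -> R) (f g : 'rV[R]_n -> R) :
  open W -> compact K -> K `<=` W ->
  (forall i x, W x -> is_derive x (delta_mx 0 i) (Y i) (dY i x)) ->
  (forall i x, W x -> {for x, continuous (dY i)}) ->
  (forall i x, ~ K x -> Y i x = 0) ->
  measurable_fun W (f : _ -> measurableTypeR R) ->
  measurable_fun W (g : _ -> measurableTypeR R) ->
  (forall x, W x -> 0 <= f x) -> (forall x, W x -> 0 <= g x) ->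
  (forall x, W x -> f x <= g x + \sum_i dY i x) ->
  (\int[lebesgue_rV n]_(x in W) (f x)%:E <=
   \int[lebesgue_rV n]_(x in W) (g x)%:E)%E.
Proof.
move=> oW cptK KW dP cd Y0 mf mg f0 g0 fg.
have mW : measurable W by exact: open_measurable_rV.
have H i := integral_partial_compact oW cptK KW (dP i) (cd i) (Y0 i).
(* An infinite right-hand side leaves nothing to prove; otherwise [g] is integrable and the integral
   of the sum splits. *)
have [goo|/negP] := pselect (\int[lebesgue_rV n]_(x in W) (g x)%:E < +oo)%E; last first.
  by rewrite -leNgt leye_eq => /eqP ->; exact: leey.
have ig : (lebesgue_rV n).-integrable W (EFin \o g).
  apply/integrableP; split; first exact/measurable_EFinP.
  rewrite (eq_integral (EFin \o g))// => x /[!inE] Wx /=.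
  by rewrite ger0_norm// g0.
have iD : (lebesgue_rV n).-integrable W (fun x => \sum_i (dY i x)%:E)%E.
  by apply: integrable_sum => //= i _; exact: (H i).1.
have D0 : (\int[lebesgue_rV n]_(x in W) (\sum_i (dY i x)%:E) = 0)%E.
  rewrite integral_sum//; last by move=> i; exact: (H i).1.
  by rewrite big1// => i _; exact: (H i).2.
rewrite -[leRHS]adde0 -D0 -integralD//.
apply: ge0_le_integral => //.
- exact/measurable_EFinP.
- move: (integrableD mW ig iD) => /integrableP[]//.
- by move=> x Wx; rewrite sumEFin -EFinD lee_fin fg.
Qed.

Lemma test_functionP W (phi : 'rV[R]_n -> R) : test_function W phi ->
  exists K, [/\ compact K, K `<=` W & forall x, ~ K x -> phi x = 0].
Proof.
move=> [_ cK KW]; exists (closure [set x | phi x != 0]); split=> // x Kx.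
by apply/eqP/negPn/negP => px; apply: Kx; apply: subset_closure.
Qed.

Lemma test_function_partial W (phi : 'rV[R]_n -> R) (i : 'I_n) x :
  test_function W phi -> is_derive x (delta_mx 0 i) phi (partial i phi x).
Proof. by move=> [+ _ _] => /(_ [::])[_ /(_ i x)]/derivableP. Qed.

Lemma test_function_continuous W (phi : 'rV[R]_n -> R) :
  test_function W phi -> continuous phi.
Proof. by move=> [+ _ _] => /(_ [::])[]. Qed.

Lemma test_function_continuous_partial W (phi : 'rV[R]_n -> R) (i : 'I_n) :
  test_function W phi -> continuous (partial i phi).
Proof. by move=> [+ _ _] => /(_ [:: i])[]. Qed.

Lemma test_function_partial2 W (phi : 'rV[R]_n -> R) (i j : 'I_n) x :
  test_function W phi ->
  is_derive x (delta_mx 0 j) (partial i phi) (partial j (partial i phi) x).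
Proof. by move=> [+ _ _] => /(_ [:: i])[_ /(_ j x)]/derivableP. Qed.

Lemma test_function_continuous_partial2 W (phi : 'rV[R]_n -> R) (i j : 'I_n) :
  test_function W phi -> continuous (partial j (partial i phi)).
Proof. by move=> [+ _ _] => /(_ [:: j; i])[]. Qed.

Lemma test_function_partial_eq0 W (phi : 'rV[R]_n -> R) K : compact K ->
  (forall x, ~ K x -> phi x = 0) -> test_function W phi ->
  forall i x, ~ K x -> partial i phi x = 0.
Proof.
move=> cptK p0 tphi i x Kx.
apply: is_derive_near0 (test_function_partial i x tphi) _.
have clK : closed K by apply: compact_closed => //; exact: norm_hausdorff.
have : nbhs x (~` K) by apply: open_nbhs_nbhs; split=> //; rewrite openC.
by apply: filterS => y; exact: p0.
Qed.

Lemma enorm_sqr (x : 'rV[R]_n) : enorm x ^+ 2 = \sum_i x 0 i ^+ 2.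
Proof. by rewrite sqr_sqrtr// sumr_ge0// => i _; rewrite sqr_ge0. Qed.

Lemma integrable_compact W K (f : 'rV[R]_n -> R) : open W -> compact K ->
  continuous f -> (forall x, ~ K x -> f x = 0) ->
  (lebesgue_rV n).-integrable W (EFin \o f).
Proof.
move=> oW cptK cf f0; have mW : measurable W by exact: open_measurable_rV.
have [M KM] := compact_norm_le cptK.
have [|C tC] := @tame_compact _ _ f M cf.
  by move=> x Mx; rewrite f0 ?expr0n// => /KM; rewrite leNgt Mx.
exact: integrableS (tame_integrable tC).
Qed.

Lemma L2_compact W K (f : 'rV[R]_n -> R) : open W -> compact K ->
  continuous f -> (forall x, ~ K x -> f x = 0) -> L2 W f.
Proof.
move=> oW cptK cf f0; split.
  exact: (measurable_funTS (D:=W) (@continuous_measurable_rV R n f cf)).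
have cf2 : continuous (fun x => f x ^+ 2).
  by move=> x; exact (for_continuousX (cf x)).
apply: integrable_lty; first exact: open_measurable_rV.
apply: (integrable_compact oW cptK cf2) => x Kx.
by rewrite f0// expr0n.
Qed.

(** The partial derivative of [u * phi] integrates to zero, and both terms of the product rule are
    continuous with compact support, so their integrals can be separated. *)
Lemma test_function_weak_gradient W u : open W -> test_function W u ->
  weak_gradient W u (gradient u).
Proof.
move=> oW tu i phi tphi.
have [K [cptK KW u0]] := test_functionP tu.
have [K2 [cptK2 KW2 phi0]] := test_functionP tphi.
have cu := test_function_continuous tu.
have cdu := test_function_continuous_partial (i:=i) tu.
have cphi := test_function_continuous tphi.
have cdphi := test_function_continuous_partial (i:=i) tphi.
pose f1 x := u x * partial i phi x.
pose f2 x := partial i u x * phi x.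
have c1 : continuous f1 by move=> x; exact (for_continuousM (cu x) (cdphi x)).
have c2 : continuous f2 by move=> x; exact (for_continuousM (cdu x) (cphi x)).
have [_ i0] : (lebesgue_rV n).-integrable W (EFin \o (f1 \+ f2)) /\
  (\int[lebesgue_rV n]_(x in W) ((f1 \+ f2) x)%:E = 0)%E.
  apply: (@integral_partial_compact W K i (fun x => u x * phi x)) => //.
  - move=> x _.
    have d1 := test_function_partial i x tu.
    have d2 := test_function_partial i x tphi.
    apply: is_derive_eq; rewrite /f1/f2 /=.
    by rewrite [phi x *: _]mulrC.
  - by move=> x _; exact (for_continuousD (c1 x) (c2 x)).
  - by move=> x /u0 ->; rewrite mul0r.
have i1 : (lebesgue_rV n).-integrable W (EFin \o f1).
  by apply: (integrable_compact oW cptK c1) => x /u0; rewrite /f1 => ->; rewrite mul0r.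
have i2 : (lebesgue_rV n).-integrable W (EFin \o f2).
  by apply: (integrable_compact oW cptK2 c2) => x /phi0; rewrite /f2 => ->; rewrite mulr0.
have mW : measurable W by exact: open_measurable_rV.
have f1fin := integrable_fin_num mW i1; have f2fin := integrable_fin_num mW i2.
have -> : (\int[lebesgue_rV n]_(x in W) (gradient u x 0 i * phi x)%:E =
  \int[lebesgue_rV n]_(x in W) (f2 x)%:E)%E.
  by apply: eq_integral => x _; rewrite /f2 mxE.
move: i0; rewrite integralD_EFin// -/(f1 _).
rewrite -(fineK f1fin) -(fineK f2fin) -EFinD -EFinN => -[] /eqP.
by rewrite addr_eq0 => /eqP ->.
Qed.

End compact_support.

Section is_derive_pointwise.
Context {R : realType} {V : normedModType R}.
Implicit Types (f g : V -> R) (x v : V).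

Lemma is_derive_add f g x v a b : is_derive x v f a -> is_derive x v g b ->
  is_derive x v (fun y => f y + g y) (a + b).
Proof. by move=> df dg; exact: is_deriveD. Qed.

Lemma is_derive_mul f g x v a b : is_derive x v f a -> is_derive x v g b ->
  is_derive x v (fun y => f y * g y) (a * g x + f x * b).
Proof.
move=> df dg; have := @is_deriveM R V f g x v a b df dg.
by rewrite [_ *: b]mulrC [g x *: _]mulrC addrC [b * _]mulrC.
Qed.

Lemma is_derive_inv f x v a : f x != 0 -> is_derive x v f a ->
  is_derive x v (fun y => (f y)^-1) (- a / f x ^+ 2).
Proof.
move=> fx0 [df <-]; split; first exact: derivableV.
by rewrite deriveV// [_ *: _]mulrC mulrN mulNr.
Qed.

Lemma derive_line f x v : 'D_1 (fun t : R => f (t *: v + x)) 0 = 'D_v f x.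
Proof.
rewrite /derive.
have -> : (fun h : R => h^-1 *: (f (h *: v + x) - f x)) =
    (fun h : R => h^-1 *: (((fun t : R => f (t *: v + x)) \o shift 0) (h *: (1 : R^o))
       - f (0 *: v + x))).
  by apply/funext => h /=; rewrite addr0 scale0r add0r [_%:A]mulr1.
by [].
Qed.

Lemma is_derive_chain f (h : R -> R) x v a b : is_derive x v f a ->
  is_derive (f x) 1 h b -> is_derive x v (fun y => h (f y)) (b * a).
Proof.
move=> [df <-] dh.
have dF : is_derive (0 : R) (1 : R) (fun t => f (t *: v + x)) ('D_v f x).
  by split; [have /derivable1P := df|rewrite derive_line].
have fx : f (0 *: v + x) = f x by rewrite scale0r add0r.
rewrite -fx in dh.
have [dhF EhF] := @is_derive1_comp R h (fun t : R => f (t *: v + x)) 0 _ _ dh dF.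
split; first exact/derivable1P.
by rewrite -EhF -derive_line.
Qed.

Lemma is_derive_sum_nat (F : nat -> V -> R) (dF : nat -> R) p q x v :
  (forall j, (p <= j < q)%N -> is_derive x v (F j) (dF j)) ->
  is_derive x v (fun y => \sum_(p <= j < q) F j y) (\sum_(p <= j < q) dF j).
Proof.
elim: q => [|q IHq] H.
  by rewrite big_geq//; under eq_fun do rewrite big_geq//; exact: is_derive_cst.
have [pq|qp] := leqP p q; last first.
  by rewrite big_geq//; under eq_fun do rewrite big_geq//; exact: is_derive_cst.
rewrite big_nat_recr//=; under eq_fun do rewrite big_nat_recr//=.
apply: is_derive_add; last by apply: H; rewrite pq/=.
by apply: IHq => j /andP[pj jq]; apply: H; rewrite pj ltnS ltnW.
Qed.

End is_derive_pointwise.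

(** * Derivatives of iterated logarithms *)

(* Radial quantities are written as functions of [s = |x|^2]. *)
Section iterated_logs.
Context {R : realType}.
Variable rho : R.
Implicit Types (s : R) (i j m : nat).

Definition ell i s : R := iterlog i (rho / Num.sqrt s).
Definition logprod j s : R := \prod_(1 <= i < j.+1) ell i s.
(** Where the logarithms are positive, this is minus the derivative of log P_m with respect to log
    |x|. *)
Definition logsum m s : R := \sum_(1 <= j < m.+1) (logprod j s)^-1.
Definition logsum2 m s : R := \sum_(1 <= j < m.+1) (logprod j s) ^- 2.

(** Positivity of the logarithms up to index [m] makes those up to index [m.+1] differentiable; the
    sign of the last one is left free. *)
Definition logpos m s := [/\ 0 < rho, 0 < s & forall i, (1 <= i <= m)%N -> 0 < ell i s].

Lemma logposW m j s : (j <= m)%N -> logpos m s -> logpos j s.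
Proof.
move=> jm [r0 s0 H]; split=> // i /andP[i1 ij]; apply: H.
by rewrite i1 (leq_trans ij).
Qed.

Lemma logprodS j s : logprod j.+1 s = logprod j s * ell j.+1 s.
Proof. by rewrite /logprod big_nat_recr. Qed.

Lemma logprod0 s : logprod 0 s = 1.
Proof. by rewrite /logprod big_geq. Qed.

Lemma logsumS m s : logsum m.+1 s = logsum m s + (logprod m.+1 s)^-1.
Proof. by rewrite /logsum big_nat_recr. Qed.

Lemma logsum2S m s : logsum2 m.+1 s = logsum2 m s + (logprod m.+1 s) ^- 2.
Proof. by rewrite /logsum2 big_nat_recr. Qed.

Lemma logprod_gt0 m s : logpos m s -> 0 < logprod m s.
Proof.
move=> [_ _ H]; rewrite /logprod big_nat; apply: prodr_gt0 => i.
by rewrite ltnS; exact: H.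
Qed.

Lemma logsum_ge0 m s : logpos m s -> 0 <= logsum m s.
Proof.
move=> H; rewrite /logsum big_nat; apply: sumr_ge0 => j; rewrite ltnS => /andP[_ jm].
by rewrite invr_ge0 ltW// logprod_gt0//; exact: logposW H.
Qed.

Lemma logsum2_ge0 m s : 0 <= logsum2 m s.
Proof. by apply: sumr_ge0 => j _; rewrite invr_ge0 sqr_ge0. Qed.

Lemma is_derive_ell0 s : 0 < s -> is_derive s 1 (ell 0) (- ell 0 s / (2 * s)).
Proof.
move=> s0; have r0 : 0 < Num.sqrt s by rewrite sqrtr_gt0.
have r2 : Num.sqrt s ^+ 2 = s by rewrite sqr_sqrtr// ltW.
have d1 := is_derive1_sqrt s0.
have d2 := is_derive_inv (lt0r_neq0 r0) d1.
have d3 := is_derive_mul (is_derive_cst rho s 1) d2.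
apply: (@is_derive_eq _ _ _ _ _ _ _ _ d3).
rewrite /ell /iterlog /cst/=; move: r2 (lt0r_neq0 r0).
by move: (Num.sqrt s) => q <- q0; field.
Qed.

Lemma is_derive_ell i s : logpos i s ->
  is_derive s 1 (ell i.+1) (- (2 * s * logprod i s)^-1).
Proof.
elim: i => [|i IHi] H; have [r0 s0 Hi] := H; have sn0 := lt0r_neq0 s0.
  have e0 : 0 < ell 0 s by rewrite divr_gt0// sqrtr_gt0.
  apply: (@is_derive_eq _ _ _ _ _ _ _ _
    (is_derive_chain (is_derive_ell0 s0) (is_derive1_ln e0))).
  by rewrite logprod0; field; rewrite sn0 lt0r_neq0.
have e0 : 0 < ell i.+1 s by apply: Hi; rewrite /= leqnn.
have Hm := logposW (leqnSn i) H.
apply: (@is_derive_eq _ _ _ _ _ _ _ _ (is_derive_chain (IHi Hm) (is_derive1_ln e0))).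
have p0 := lt0r_neq0 (logprod_gt0 Hm).
by rewrite logprodS; field; rewrite sn0 p0 lt0r_neq0.
Qed.

Lemma is_derive_logprod j s : logpos j s ->
  is_derive s 1 (logprod j) (- logprod j s * logsum j s / (2 * s)).
Proof.
elim: j => [|j IHj] H; have [r0 s0 Hi] := H; have sn0 := lt0r_neq0 s0.
  rewrite /logsum big_geq// mulr0 mul0r.
  rewrite (_ : logprod 0 = cst 1); last by apply/funext => t; rewrite logprod0.
  exact: is_derive_cst.
rewrite (_ : logprod j.+1 = fun t => logprod j t * ell j.+1 t); last first.
  by apply/funext => t; rewrite logprodS.
have Hj := logposW (leqnSn j) H.
apply: (@is_derive_eq _ _ _ _ _ _ _ _ (is_derive_mul (IHj Hj) (is_derive_ell Hj))).
have p0 := lt0r_neq0 (logprod_gt0 Hj).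
have e0 : ell j.+1 s != 0 by rewrite lt0r_neq0// Hi//= leqnn.
by rewrite logsumS logprodS; field; rewrite sn0 p0 e0.
Qed.

(** The derivative of 1/P_j is S_j / (2 s P_j), where S_j is the partial sum up to j. Summing S_j /
    P_j counts each unordered pair of indices once, which gives half of the square of the sum plus
    half of the sum of squares. This closed form is what makes the Riccati identity for [F]
    exact. *)
Lemma is_derive_logsum m s : logpos m s ->
  is_derive s 1 (logsum m) ((logsum m s ^+ 2 + logsum2 m s) / (4 * s)).
Proof.
elim: m => [|m IHm] H; have [r0 s0 Hi] := H; have sn0 := lt0r_neq0 s0.
  rewrite /logsum2 /logsum !big_geq// expr0n addr0 mul0r.
  by under eq_fun do rewrite big_geq//; exact: is_derive_cst.
rewrite (_ : logsum m.+1 = fun t => logsum m t + (logprod m.+1 t)^-1); last first.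
  by apply/funext => t; rewrite logsumS.
have Hm := logposW (leqnSn m) H.
have p0 := lt0r_neq0 (logprod_gt0 H).
apply: (@is_derive_eq _ _ _ _ _ _ _ _
  (is_derive_add (IHm Hm) (is_derive_inv p0 (is_derive_logprod H)))).
by rewrite logsumS logsum2S; field; rewrite sn0 p0.
Qed.

End iterated_logs.

Section squared_norm.
Context {R : realType} {n : nat}.
Implicit Types (x : 'rV[R]_n) (i : 'I_n).

Definition sqnorm x : R := \sum_i x 0 i ^+ 2.

Lemma sqnorm_ge0 x : 0 <= sqnorm x.
Proof. by apply: sumr_ge0 => i _; rewrite sqr_ge0. Qed.

Lemma sqnorm_gt0 x : x != 0 -> 0 < sqnorm x.
Proof.
move=> x0; rewrite lt0r sqnorm_ge0 andbT; apply: contra x0.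
rewrite psumr_eq0 => [/allP H|i _]; last exact: sqr_ge0.
apply/eqP/rowP => i; rewrite mxE; apply/eqP; rewrite -sqrf_eq0.
by apply: H; rewrite mem_index_enum.
Qed.

Lemma is_derive_coord i j x :
  is_derive x (delta_mx 0 i) (fun y : 'rV[R]_n => y 0 j) (j == i)%:R.
Proof.
have E : (fun h : R => h^-1 *: (((fun y : 'rV[R]_n => y 0 j) \o shift x)
    (h *: (delta_mx 0 i : 'rV[R]_n)) - x 0 j)) @ 0^' --> ((j == i)%:R : R).
  apply: (@cvg_trans _ (cst ((j == i)%:R : R) @ 0^')); last exact: cvg_cst.
  apply: near_eq_cvg; near=> h => /=.
  have h0 : h != 0 by near: h; exact: nbhs_dnbhs_neq.
  by rewrite !mxE/= addrK /GRing.scale/= mulrA mulVf// mul1r.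
split; first by apply/cvg_ex; eexists; exact: E.
by apply/cvg_lim => //; exact: norm_hausdorff.
Unshelve. all: by end_near. Qed.

Lemma is_derive_sqnorm i x : is_derive x (delta_mx 0 i) sqnorm (2 * x 0 i).
Proof.
have H (j : 'I_n) : is_derive x (delta_mx 0 i) (fun y : 'rV[R]_n => y 0 j ^+ 2)
    (2 * x 0 j * (j == i)%:R).
  have d := is_derive_coord i j x.
  apply: (@is_derive_eq _ _ _ _ _ _ _ _ (is_derive_mul d d)).
  by rewrite mulrC -mulrDl -mulr2n mulr_natl.
have := @is_derive_sum R _ _ n (fun j (y : 'rV[R]_n) => y 0 j ^+ 2) x (delta_mx 0 i) _ H.
rewrite (_ : \sum_(j < n) _ = sqnorm); last first.
  by apply/funext => y; rewrite fct_sumE.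
move=> dsum; apply: (@is_derive_eq _ _ _ _ _ _ _ _ dsum).
rewrite (bigD1 i)//= eqxx mulr1 big1 ?addr0// => j /negPf ->.
by rewrite mulr0.
Qed.

Lemma continuous_sqnorm x : {for x, continuous sqnorm}.
Proof.
apply: for_continuous_sum => i; apply: (@for_continuousX _ _ (fun y => y 0 i)).
exact: for_continuous_coord.
Qed.

Lemma is_derive_continuous (f : R -> R) (s d : R) : is_derive s 1 f d ->
  {for s, continuous f}.
Proof. by move=> [df _]; apply/differentiable_continuous/derivable1_diffP. Qed.

End squared_norm.

(** * Positivity of the iterated logarithms below an exponential tower *)

Section log_positivity.
Context {R : realType}.

Lemma exp_tower_ge1 k : 1 <= exp_tower k :> R.
Proof.
elim: k => [//|k IHk]; rewrite /exp_tower/= -/(exp_tower k).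
by rewrite (le_trans _ (expR_ge1Dx _))// lerDl (le_trans _ IHk).
Qed.

(** The k-th logarithm of the tower is 1, so that of [y] exceeds 1 and one further logarithm is
    still positive; hence the bound [k.+1] on the index. *)
Lemma iterlog_gt0 k (y : R) : exp_tower k < y ->
  forall i, (i <= k.+1)%N -> 0 < iterlog i y.
Proof.
have T1 := exp_tower_ge1.
elim: k y => [|k IHk] y ky [|i] ik.
- exact: le_lt_trans ky.
- move: ik; rewrite ltnS leqn0 => /eqP ->; rewrite /iterlog/=.
  by rewrite ln_gt0.
- by apply: lt_trans ky; exact: lt_le_trans (T1 _).
- rewrite /iterlog iterSr; apply: IHk => //.
  rewrite -ltr_expR lnK//; rewrite posrE; apply: lt_trans ky.
  exact: lt_le_trans (T1 _).
Qed.

(** The bound 2 D^2 instead of D^2 leaves room for |x|^2 + e^2 with e <= D. The loss, a factor below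
    2 in the argument of the logarithms, is absorbed by one level of the tower: e^T = e * e^(T-1) >=
    2 T. *)
Lemma logpos_tower k (D s : R) : 0 < D -> 0 < s -> s <= 2 * D ^+ 2 ->
  logpos (D * exp_tower k.+1) k.+1 s.
Proof.
move=> D0 s0 sD; have T1 := exp_tower_ge1 k.
have T0 : 0 < exp_tower k :> R by exact: lt_le_trans T1.
have r0 : 0 < Num.sqrt s by rewrite sqrtr_gt0.
split=> //; first by rewrite mulr_gt0// (lt_le_trans ltr01)// exp_tower_ge1.
move=> i /andP[_ ik]; apply: iterlog_gt0 ik.
rewrite ltr_pdivlMr//.
have s2 : Num.sqrt s < 2 * D.
  rewrite -(@ltr_pXn2r _ 2)// ?nnegrE ?sqrtr_ge0 ?mulr_ge0//; last exact: ltW.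
  by rewrite sqr_sqrtr ?ltW//; nra.
have e2 : 2 * exp_tower k <= exp_tower k.+1 :> R.
  rewrite [exp_tower k.+1]/exp_tower/= -/(exp_tower k).
  rewrite -[in leRHS](subrK 1 (exp_tower k)) expRD mulrC ler_pM//; first exact: ltW.
    by rewrite (le_trans _ (expR_ge1Dx _))// addrC subrK.
  by rewrite (le_trans _ (expR_ge1Dx _)).
by nra.
Qed.

End log_positivity.

(** * The improved Hardy inequality *)

Section hardy_test_functions.
Context {R : realType} {n : nat}.
Implicit Types (W : set 'rV[R]_n) (x : 'rV[R]_n).
Variables (rho : R) (m : nat).

Let c0 : R := (n%:R - 2) / 2.

(* [x |-> profile (|x|^2) *: x] is the vector field [F = - grad w / w]. *)
Definition profile (s : R) : R := (c0 + logsum rho m s / 2) / s.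
Definition profile' (s : R) : R :=
  (logsum rho m s ^+ 2 + logsum2 rho m s) / (8 * s ^+ 2)
  - (c0 + logsum rho m s / 2) / s ^+ 2.

Lemma is_derive_profile s : logpos rho m s ->
  is_derive s 1 profile (profile' s).
Proof.
move=> H; have [_ s0 _] := H; have sn0 := lt0r_neq0 s0.
have dS := is_derive_mul (is_derive_logsum H) (is_derive_cst (2^-1 : R) s 1).
have dn := is_derive_add (is_derive_cst c0 s 1) dS.
apply: (@is_derive_eq _ _ _ _ _ _ _ _
  (is_derive_mul dn (is_derive_inv sn0 (is_derive_id s 1)))).
by rewrite /profile' /cst/=; field.
Qed.

Lemma continuous_logsum s : logpos rho m s -> {for s, continuous (logsum rho m)}.
Proof. by move=> /is_derive_logsum; exact: is_derive_continuous. Qed.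

Lemma continuous_logsum2 s : logpos rho m s -> {for s, continuous (logsum2 rho m)}.
Proof.
move=> H; rewrite /logsum2.
have [d] : exists d, is_derive s 1 (fun t => \sum_(1 <= j < m.+1) (logprod rho j t) ^- 2) d.
  eexists; apply: is_derive_sum_nat => j; rewrite ltnS => /andP[_ jm].
  have Hj := logposW jm H.
  have p0 := lt0r_neq0 (logprod_gt0 Hj).
  have dp := is_derive_logprod Hj.
  have p20 : logprod rho j s * logprod rho j s != 0 by rewrite mulf_neq0.
  exact (@is_derive_inv _ _ (fun t => logprod rho j t * logprod rho j t) s 1 _ p20
    (is_derive_mul dp dp)).
exact: is_derive_continuous.
Qed.

Lemma continuous_profile s : logpos rho m s -> {for s, continuous profile}.
Proof. by move=> /is_derive_profile; exact: is_derive_continuous. Qed.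

Lemma continuous_profile' s : logpos rho m s -> {for s, continuous profile'}.
Proof.
move=> H; have [_ s0 _] := H; have sn0 := lt0r_neq0 s0.
have cS := continuous_logsum H; have cQ := continuous_logsum2 H.
rewrite /profile' /prop_for /continuous_at.
have c2 : (t ^+ 2 @[t --> s] --> s ^+ 2) by exact: exprn_continuous.
apply: cvgB; apply: cvgM.
- by apply: cvgD => //; apply: cvgM.
- by apply: cvgV; [rewrite mulf_neq0 ?expf_neq0//|apply: cvgM; [exact: cvg_cst|]].
- by apply: cvgD; [exact: cvg_cst|apply: cvgM; [|exact: cvg_cst]].
- by apply: cvgV; [rewrite expf_neq0|].
Qed.

(** For s = |x|^2 and z = s + e^2 the right-hand side is div F - |F|^2 for the regularised field.
    The two sides agree at s = z; in general they differ by a multiple of z - s whose sign is that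
    of c0 + S/2, nonnegative for n >= 2. *)
Lemma profile_ge s z : (2 <= n)%N -> logpos rho m z -> 0 <= s <= z ->
  s / z ^+ 2 * (c0 ^+ 2 + logsum2 rho m z / 4) <=
  n%:R * profile z + 2 * s * profile' z - s * profile z ^+ 2.
Proof.
move=> n2 H /andP[s0 sz]; have [_ z0 _] := H; have zn0 := lt0r_neq0 z0.
have c00 : 0 <= c0 by rewrite divr_ge0// subr_ge0 ler_nat.
have nE : n%:R = 2 * c0 + 2 by rewrite /c0; field.
rewrite -subr_ge0 /profile /profile' nE.
have S0 := logsum_ge0 H.
set S := logsum _ _ _ in S0 *; set Q := logsum2 _ _ _.
rewrite (_ : _ - _ = (2 * c0 + 2) * (c0 + S / 2) * (z - s) / z ^+ 2); last by field.
by rewrite !mulr_ge0// ?invr_ge0 ?sqr_ge0 ?subr_ge0// addr_ge0// ?divr_ge0// mulr_ge0.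
Qed.

(** [Pot] is any measurable function between 0 and the regularised potential, so that its
    truncations are covered as well. *)
Lemma hardy_test_function W (e : R) (phi Pot : 'rV[R]_n -> R) : (2 <= n)%N -> open W ->
  (forall x, W x -> logpos rho m (sqnorm x + e ^+ 2)) ->
  test_function W phi ->
  measurable_fun W (Pot : _ -> measurableTypeR R) ->
  (forall x, W x -> 0 <= Pot x <= sqnorm x / (sqnorm x + e ^+ 2) ^+ 2 *
      (c0 ^+ 2 + logsum2 rho m (sqnorm x + e ^+ 2) / 4)) ->
  (\int[lebesgue_rV n]_(x in W) (phi x ^+ 2 * Pot x)%:E <=
   \int[lebesgue_rV n]_(x in W) (enorm (gradient phi x) ^+ 2)%:E)%E.
Proof.
move=> n2 oW lW tphi mPot PotP; have mW : measurable W by exact: open_measurable_rV.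
have [K [cptK KW phi0]] := test_functionP tphi.
have cphi := test_function_continuous tphi.
have cd i := test_function_continuous_partial (i := i) tphi.
have mphi := measurable_funTS (D:=W) (continuous_measurable_rV cphi).
pose sq x := sqnorm x + e ^+ 2.
pose Y i x := phi x * phi x * (x 0 i * profile (sq x)).
pose dY i x := (partial i phi x * phi x + phi x * partial i phi x) * (x 0 i * profile (sq x)) +
   phi x * phi x * (1 * profile (sq x) + x 0 i * (profile' (sq x) * (2 * x 0 i))).
have csq x : {for x, continuous sq}.
  by apply: for_continuousD; [exact: continuous_sqnorm|exact: cst_continuous].
apply: (@le_integral_div _ _ W K Y dY).
- exact: oW.
- exact: cptK.
- exact: KW.
- move=> i x Wx.
  have d1 := test_function_partial i x tphi.
  have d2 := is_derive_coord i i x; rewrite eqxx in d2.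
  have dq := is_derive_add (is_derive_sqnorm i x) (is_derive_cst (e ^+ 2) x (delta_mx 0 i)).
  have d3 := is_derive_chain dq (is_derive_profile (lW x Wx)).
  apply: (@is_derive_eq _ _ _ _ _ _ _ _
    (is_derive_mul (is_derive_mul d1 d1) (is_derive_mul d2 d3))).
  by rewrite /dY addr0.
- move=> i x Wx.
  have c1 : {for x, continuous (fun y : 'rV[R]_n => y 0 i)} by exact: for_continuous_coord.
  have k1 : {for x, continuous (fun _ : 'rV[R]_n => 1 : R)} by exact: cst_continuous.
  have k2 : {for x, continuous (fun _ : 'rV[R]_n => 2 : R)} by exact: cst_continuous.
  have c2 : {for x, continuous (fun y => profile (sq y))}.
    by apply: for_continuous_comp; [exact: csq|exact/continuous_profile/lW].
  have c3 : {for x, continuous (fun y => profile' (sq y))}.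
    by apply: for_continuous_comp; [exact: csq|exact/continuous_profile'/lW].
  have c4 := for_continuousM (cd i x) (cphi x).
  have c5 := for_continuousM (cphi x) (cd i x).
  have c6 := for_continuousM k2 c1.
  have c7 := for_continuousM k1 c2.
  exact (for_continuousD
    (for_continuousM (for_continuousD c4 c5) (for_continuousM c1 c2))
    (for_continuousM (for_continuousM (cphi x) (cphi x))
      (for_continuousD c7 (for_continuousM c1 (for_continuousM c3 c6))))).
- by move=> i x Kx; rewrite /Y phi0// !mul0r.
- apply: measurable_funM => //; exact: measurable_funX.
- rewrite (_ : (fun x => _) = fun x => \sum_i partial i phi x ^+ 2); last first.
    apply/funext => x; rewrite enorm_sqr; apply: eq_bigr => i _.
    by rewrite mxE.
  apply: measurable_funTS; apply: continuous_measurable_rV => x.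
  by apply: for_continuous_sum => i; exact (for_continuousX (cd i x)).
- by move=> x Wx; rewrite mulr_ge0 ?sqr_ge0//; case/andP: (PotP x Wx).
- by move=> x Wx; rewrite sqr_ge0.
- move=> x Wx; have /andP[_ Px] := PotP x Wx.
  rewrite enorm_sqr; under eq_bigr do rewrite mxE.
  have H := lW x Wx.
  have s0 := sqnorm_ge0 x.
  have sz : 0 <= sqnorm x <= sq x by rewrite s0 lerDl sqr_ge0.
  have Hid := profile_ge n2 H sz.
  (* The completed square: |grad phi|^2 + div(phi^2 F) = |grad phi + phi F|^2 + phi^2 (div F -
     |F|^2). *)
  have E : \sum_i partial i phi x ^+ 2 + \sum_i dY i x =
    \sum_i (partial i phi x + phi x * (x 0 i * profile (sq x))) ^+ 2 +
    phi x ^+ 2 * (n%:R * profile (sq x) + 2 * sqnorm x * profile' (sq x) -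
       sqnorm x * profile (sq x) ^+ 2).
    rewrite /dY; move: (profile (sq x)) (profile' (sq x)) => p p'.
    have -> : n%:R * p = \sum_(i < n) p by rewrite sumr_const card_ord mulr_natl.
    rewrite -addrA.
    have -> : 2 * sqnorm x * p' - sqnorm x * p ^+ 2 =
        \sum_i (2 * x 0 i ^+ 2 * p' - x 0 i ^+ 2 * p ^+ 2).
      by rewrite sumrB -!mulr_suml -mulr_sumr.
    rewrite mulrDr !mulr_sumr -!big_split/=.
    by apply: eq_bigr => i _; ring.
  rewrite E; apply: (@le_trans _ _ (phi x ^+ 2 * (n%:R * profile (sq x) +
      2 * sqnorm x * profile' (sq x) - sqnorm x * profile (sq x) ^+ 2))).
    by rewrite ler_wpM2l ?sqr_ge0// (le_trans Px).
  by rewrite lerDr sumr_ge0// => i _; rewrite sqr_ge0.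
Qed.

End hardy_test_functions.

Section integral_combination.
Context d (T : measurableType d) (R : realType) (mu : {measure set T -> \bar R}).

Lemma le_integral_comb (D : set T) (f g h : T -> R) (a b : R) : measurable D ->
  measurable_fun D f -> measurable_fun D g -> measurable_fun D h ->
  (forall x, D x -> 0 <= f x) -> (forall x, D x -> 0 <= g x) ->
  (forall x, D x -> 0 <= h x) -> 0 <= a -> 0 <= b ->
  (forall x, D x -> f x <= a * g x + b * h x) ->
  (\int[mu]_(x in D) (f x)%:E <=
   a%:E * \int[mu]_(x in D) (g x)%:E + b%:E * \int[mu]_(x in D) (h x)%:E)%E.
Proof.
move=> mD mf mg mh f0 g0 h0 a0 b0 fgh.
have mg' : measurable_fun D (fun x => (g x)%:E) by exact/measurable_EFinP.
have mh' : measurable_fun D (fun x => (h x)%:E) by exact/measurable_EFinP.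
rewrite -ge0_integralZl_EFin//.
rewrite -ge0_integralZl_EFin//.
rewrite -ge0_integralD//.
- apply: ge0_le_integral => //.
  + exact/measurable_EFinP.
  + by apply: emeasurable_funD; exact: measurable_funeM.
- by move=> x Dx; rewrite -EFinM lee_fin mulr_ge0// g0.
- exact: measurable_funeM.
- by move=> x Dx; rewrite -EFinM lee_fin mulr_ge0// h0.
- exact: measurable_funeM.
Qed.

End integral_combination.

(** * From test functions to H^1_0 *)

Section hardy_sobolev.
Context {R : realType} {n : nat}.
Implicit Types (W : set 'rV[R]_n) (u : 'rV[R]_n -> R) (g : 'rV[R]_n -> 'rV[R]_n).

Lemma sqr_comb_le (d a b : R) : 0 < d ->
  (a + b) ^+ 2 <= (1 + d) * a ^+ 2 + (1 + d^-1) * b ^+ 2.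
Proof.
move=> d0; rewrite -subr_ge0.
have -> : (1 + d) * a ^+ 2 + (1 + d^-1) * b ^+ 2 - (a + b) ^+ 2 =
    (d * a - b) ^+ 2 / d by field; rewrite lt0r_neq0.
by rewrite divr_ge0 ?sqr_ge0// ltW.
Qed.

Lemma enorm_comb_le (d : R) (x y : 'rV[R]_n) : 0 < d ->
  enorm (x + y) ^+ 2 <= (1 + d) * enorm x ^+ 2 + (1 + d^-1) * enorm y ^+ 2.
Proof.
move=> d0; rewrite !enorm_sqr !mulr_sumr -big_split/=.
by apply: ler_sum => i _; rewrite mxE sqr_comb_le.
Qed.

Lemma measurable_enorm_sqr W g :
  (forall i, measurable_fun W (fun x => g x 0 i : measurableTypeR R)) ->
  measurable_fun W (fun x => enorm (g x) ^+ 2 : measurableTypeR R).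
Proof.
move=> mg; rewrite (_ : (fun x => _) = fun x => \sum_i g x 0 i ^+ 2).
  by apply: measurable_sum => i; apply: measurable_funX; exact: mg.
by apply/funext => x; rewrite enorm_sqr.
Qed.

Lemma L2_enorm W g : open W -> (forall i, L2 W (fun x => g x 0 i)) ->
  (\int[lebesgue_rV n]_(x in W) (enorm (g x) ^+ 2)%:E < +oo)%E.
Proof.
move=> oW Lg; have mW : measurable W by exact: open_measurable_rV.
under eq_integral do rewrite enorm_sqr -sumEFin.
rewrite ge0_integral_sum//; last 2 first.
- by move=> i; apply/measurable_EFinP/measurable_funX; case: (Lg i).
- by move=> i x _; rewrite lee_fin sqr_ge0.
by apply: lte_sum_pinfty => i _; case: (Lg i).
Qed.

(** Boundedness of the weight turns L^2 closeness of [phi] to [u] into closeness of the weighted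
    integrals. Splitting squares with the factors 1 + d and 1 + 1/d makes a single approximant
    sufficient for each [d], at the price of a factor (1 + d)^2 and an error [d]. *)
Lemma hardy_H10_bounded W u g (Pot : 'rV[R]_n -> R) (C : R) : open W ->
  sobolevH10 W u g -> measurable_fun W (Pot : _ -> measurableTypeR R) ->
  (forall x, W x -> 0 <= Pot x <= C) ->
  (forall phi, test_function W phi ->
    (\int[lebesgue_rV n]_(x in W) (phi x ^+ 2 * Pot x)%:E <=
     \int[lebesgue_rV n]_(x in W) (enorm (gradient phi x) ^+ 2)%:E)%E) ->
  (\int[lebesgue_rV n]_(x in W) (u x ^+ 2 * Pot x)%:E <=
   \int[lebesgue_rV n]_(x in W) (enorm (g x) ^+ 2)%:E)%E.
Proof.
move=> oW [[Lu Lg wg] app] mPot PotC Hphi.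
have mW : measurable W by exact: open_measurable_rV.
have Goo := L2_enorm oW Lg.
set A := (\int[lebesgue_rV n]_(x in W) (u x ^+ 2 * Pot x)%:E)%E.
move: Goo; set G := (\int[lebesgue_rV n]_(x in W) _)%E => Goo.
have G0 : (0 <= G)%E by apply: integral_ge0 => x _; rewrite lee_fin sqr_ge0.
have Gfin : G \is a fin_num by rewrite ge0_fin_numE.
have mu2 : measurable_fun W u by case: Lu.
have C0 : 0 <= `|C| by [].
have key d : 0 < d -> (A <= ((1 + d) ^+ 2)%:E * G + d%:E)%E.
  (* [K] dominates both error coefficients, (1 + 1/d) |C| for the functions and (1 + d)(1 + 1/d) for
     the gradients; an approximation with squared error below d/K then costs at most [d]. *)
  move=> d0; pose K := (1 + d^-1) * (1 + d + `|C|).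
  have dn0 : 0 < d^-1 by rewrite invr_gt0.
  have d10 : 0 <= 1 + d by lra.
  have dn10 : 0 <= 1 + d^-1 by lra.
  have K0 : 0 < K by apply: mulr_gt0; lra.
  have e0 : 0 < Num.sqrt (d / K) by rewrite sqrtr_gt0 divr_gt0.
  have [phi tphi] := app _ e0; rewrite sqr_sqrtr; last by rewrite divr_ge0// ltW.
  have cphi := test_function_continuous tphi.
  have mphi := measurable_funTS (D:=W) (continuous_measurable_rV cphi).
  have mdphi i : measurable_fun W (fun x => gradient phi x 0 i).
    rewrite (_ : (fun x => _) = partial i phi); last by apply/funext => x; rewrite mxE.
    exact: (measurable_funTS (D:=W) (continuous_measurable_rV
      (test_function_continuous_partial (i:=i) tphi))).
  set E1 := (\int[lebesgue_rV n]_(x in W) ((u x - phi x) ^+ 2)%:E)%E.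
  set E2 := (\int[lebesgue_rV n]_(x in W) (enorm (g x - gradient phi x) ^+ 2)%:E)%E.
  have E10 : (0 <= E1)%E by apply: integral_ge0 => x _; rewrite lee_fin sqr_ge0.
  have E20 : (0 <= E2)%E by apply: integral_ge0 => x _; rewrite lee_fin sqr_ge0.
  move=> E12.
  have E1fin : E1 \is a fin_num.
    by rewrite ge0_fin_numE// (le_lt_trans _ (lt_le_trans E12 (leey _)))// leeDl.
  have E2fin : E2 \is a fin_num.
    by rewrite ge0_fin_numE// (le_lt_trans _ (lt_le_trans E12 (leey _)))// leeDr.
  have mg i : measurable_fun W (fun x => g x 0 i) by case: (Lg i).
  have S1 : (A <= (1 + d)%:E * (\int[lebesgue_rV n]_(x in W) (phi x ^+ 2 * Pot x)%:E)
      + ((1 + d^-1) * `|C|)%:E * E1)%E.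
    apply: le_integral_comb => //.
    - by apply: measurable_funM => //; exact: measurable_funX.
    - by apply: measurable_funM => //; exact: measurable_funX.
    - by apply: measurable_funX; exact: measurable_funB.
    - by move=> x Wx; rewrite mulr_ge0 ?sqr_ge0//; case/andP: (PotC x Wx).
    - by move=> x Wx; rewrite mulr_ge0 ?sqr_ge0//; case/andP: (PotC x Wx).
    - by move=> x Wx; rewrite sqr_ge0.
    - exact: mulr_ge0.
    - move=> x Wx; have /andP[P0 PC] := PotC x Wx.
      have := sqr_comb_le (phi x) (u x - phi x) d0; rewrite addrC subrK => Hs.
      apply: le_trans (ler_wpM2r P0 Hs) _.
      move: ((u x - phi x) ^+ 2) (sqr_ge0 (u x - phi x)) => q q0.
      rewrite mulrDl -!mulrA lerD2l ler_wpM2l// mulrC ler_wpM2r//.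
      by rewrite (le_trans PC)// ler_norm.
  have S2 : (\int[lebesgue_rV n]_(x in W) (enorm (gradient phi x) ^+ 2)%:E <=
      (1 + d)%:E * G + (1 + d^-1)%:E * E2)%E.
    apply: le_integral_comb => //.
    - exact: measurable_enorm_sqr.
    - exact: measurable_enorm_sqr.
    - apply: measurable_enorm_sqr => i; rewrite (_ : (fun x => _) = fun x => g x 0 i - gradient phi x 0 i).
        exact: measurable_funB.
      by apply/funext => x; rewrite !mxE.
    - by move=> x Wx; rewrite sqr_ge0.
    - by move=> x Wx; rewrite sqr_ge0.
    - by move=> x Wx; rewrite sqr_ge0.
    - move=> x Wx; have -> : gradient phi x = g x + (- (g x - gradient phi x)).
        by rewrite opprB addrC subrK.
      have := enorm_comb_le (g x) (- (g x - gradient phi x)) d0.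
      suff -> : enorm (- (g x - gradient phi x)) = enorm (g x - gradient phi x).
        by rewrite opprB addrC subrK.
      by rewrite /enorm; congr Num.sqrt; apply: eq_bigr => i _; rewrite mxE sqrrN.
  have S3 := le_trans (Hphi _ tphi) S2.
  apply: (le_trans S1).
  apply: (@le_trans _ _ ((1 + d)%:E * ((1 + d)%:E * G + (1 + d^-1)%:E * E2)
      + ((1 + d^-1) * `|C|)%:E * E1)%E).
    by apply: leeD2r; apply: lee_wpmul2l => //; rewrite lee_fin.
  move: E12; rewrite -(fineK E1fin) -(fineK E2fin) -(fineK Gfin).
  have := fine_ge0 E10; have := fine_ge0 E20; have := fine_ge0 G0.
  move: (fine E1) (fine E2) (fine G) => e1 e2 gg gg0 e20 e10.
  rewrite -!EFinD lte_fin lee_fin ltr_pdivlMr// => H.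
  have : (1 + d) * (1 + d^-1) * e2 + (1 + d^-1) * `|C| * e1 <= (e1 + e2) * K.
    rewrite /K -subr_ge0.
    have -> : (e1 + e2) * ((1 + d^-1) * (1 + d + `|C|)) -
       ((1 + d) * (1 + d^-1) * e2 + (1 + d^-1) * `|C| * e1) =
       (1 + d^-1) * (e1 * (1 + d) + e2 * `|C|) by ring.
    by rewrite mulr_ge0// addr_ge0// mulr_ge0.
  nra.
apply/lee_addgt0Pr => e e0; have g0 := fine_ge0 G0.
(* For d <= 1 one has (1 + d)^2 <= 1 + 3 d, so the total excess is at most d (3 G + 1). *)
pose d := Num.min 1 (e / (3 * fine G + 1)).
have q0 : 0 < 3 * fine G + 1 by rewrite ltr_pwDr// mulr_ge0.
have d0 : 0 < d by rewrite /d lt_min ltr01 divr_gt0.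
have d1 : d <= 1 by rewrite /d ge_min lexx.
have d2 : d * (3 * fine G + 1) <= e by rewrite -ler_pdivlMr// /d ge_min lexx orbT.
apply: le_trans (key d d0) _; rewrite -(fineK Gfin) -EFinM -!EFinD lee_fin.
have h : 0 <= d * (1 - d) * fine G by rewrite !mulr_ge0 ?subr_ge0// ltW.
rewrite -subr_ge0.
have -> : fine G + e - ((1 + d) ^+ 2 * fine G + d) =
    (e - d * (3 * fine G + 1)) + d * (1 - d) * fine G by ring.
by rewrite addr_ge0// subr_ge0.
Qed.

End hardy_sobolev.

Section hardy_improved.
Context {R : realType} {n : nat}.
Implicit Types (W : set 'rV[R]_n) (u : 'rV[R]_n -> R) (g : 'rV[R]_n -> 'rV[R]_n).

Lemma hardy_H10 W (D : R) (k m : nat) u g : (2 <= n)%N -> open W -> 0 < D ->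
  (forall x, W x -> sqnorm x <= D ^+ 2) -> (m <= k.+1)%N ->
  sobolevH10 W u g ->
  (\int[lebesgue_rV n]_(x in W) (u x ^+ 2 * ((sqnorm x)^-1 *
     (((n%:R - 2) / 2) ^+ 2 +
      logsum2 (D * exp_tower k.+1) m (sqnorm x) / 4)))%:E <=
   \int[lebesgue_rV n]_(x in W) (enorm (g x) ^+ 2)%:E)%E.
Proof.
move=> n2 oW D0 WD mk Hug; have mW : measurable W by exact: open_measurable_rV.
set rho := D * _; set c := ((n%:R - 2) / 2) ^+ 2.
have c0 : 0 <= c by rewrite sqr_ge0.
(* The shift D/(N+1) never exceeds [D], so |x|^2 + eps^2 stays below 2 D^2, where all the logarithms
   are positive. *)
pose eps N : R := D * harmonic N.
have eps0 N : 0 < eps N by rewrite mulr_gt0 ?invr_gt0.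
have epsD N : eps N ^+ 2 <= D ^+ 2.
  rewrite ler_pXn2r ?nnegrE ?(ltW (eps0 N)) ?(ltW D0)//.
  by rewrite /eps ger_pMr// invf_le1// ler1n.
have lp N x : W x -> logpos rho m (sqnorm x + eps N ^+ 2).
  move=> Wx; apply: logposW mk _; apply: logpos_tower => //.
    by rewrite ltr_wpDl ?sqnorm_ge0 ?exprn_gt0.
  by rewrite mulr2n mulrDl mul1r lerD// WD.
pose h s z := s / z ^+ 2 * (c + logsum2 rho m z / 4).
have h0 s z : 0 <= s -> 0 <= h s z.
  move=> s0; rewrite /h mulr_ge0//; first by rewrite divr_ge0 ?sqr_ge0.
  by rewrite addr_ge0// divr_ge0// logsum2_ge0.
(* The same index governs regularisation and truncation, so one application of Fatou's lemma removes
   both. *)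
pose Pot N (x : 'rV[R]_n) : R := Num.min (h (sqnorm x) (sqnorm x + eps N ^+ 2)) N.+1%:R.
have mPot N : measurable_fun W (Pot N : _ -> measurableTypeR R).
  apply: measurable_minr => //; apply: open_continuous_measurable_rV => // x.
  rewrite inE => Wx; have [_ z0 _] := lp N x Wx.
  have cs : {for x, continuous (@sqnorm R n)} by exact: continuous_sqnorm.
  have ce : {for x, continuous (fun _ : 'rV[R]_n => eps N ^+ 2)} by exact: cst_continuous.
  have cc : {for x, continuous (fun _ : 'rV[R]_n => c)} by exact: cst_continuous.
  have c4 : {for x, continuous (fun _ : 'rV[R]_n => 4^-1 : R)} by exact: cst_continuous.
  have cz := for_continuousD cs ce.
  have cQ := for_continuous_comp cz (continuous_logsum2 (lp N x Wx)).
  have cz2 := for_continuousX (k := 2) cz.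
  have ci : {for x, continuous (fun y => ((sqnorm y + eps N ^+ 2) ^+ 2)^-1)}.
    apply: (@for_continuous_comp _ _ (fun y => (sqnorm y + eps N ^+ 2) ^+ 2) (fun t => t^-1)) => //.
    by apply: inv_continuous; rewrite expf_neq0// lt0r_neq0.
  exact (for_continuousM (for_continuousM cs ci) (for_continuousD cc (for_continuousM cQ c4))).
have PotP N x : 0 <= Pot N x by rewrite /Pot le_min h0 ?sqnorm_ge0/=.
pose f N x := (u x ^+ 2 * Pot N x)%:E.
have fG N : (\int[lebesgue_rV n]_(x in W) f N x <=
   \int[lebesgue_rV n]_(x in W) (enorm (g x) ^+ 2)%:E)%E.
  apply: (@hardy_H10_bounded _ _ W u g (Pot N) N.+1%:R) => // [x Wx|phi tphi].
    by rewrite PotP/= /Pot ge_min lexx orbT.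
  apply: (@hardy_test_function _ _ rho m W (eps N)) => // [x Wx|x Wx]; first exact: lp.
  by rewrite PotP/= /Pot ge_min lexx.
have mu : measurable_fun W u by case: Hug => -[[]].
have mf N : measurable_fun W (f N).
  rewrite (_ : f N = EFin \o (fun x => u x ^+ 2 * Pot N x))//.
  apply/measurable_EFinP; apply: measurable_funM; last exact: mPot.
  exact: measurable_funX.
have f0 N x : W x -> (0 <= f N x)%E.
  by move=> _; rewrite lee_fin mulr_ge0 ?sqr_ge0.
have := fatou (lebesgue_rV n) mW mf f0.
set I1 := (\int[_]_(x in W) _)%E; set I2 := (\int[_]_(x in W) _)%E.
have <- : I1 = I2.
  apply: eq_integral => x; rewrite inE => Wx.
  (* At the origin both integrands are 0: the factor |x|^2 kills the regularised potential, and the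
     limit potential contains the inverse of 0, which is 0 by convention. *)
  have [->|x0] := eqVneq x 0.
    have s0 : sqnorm (0 : 'rV[R]_n) = 0.
      by rewrite /sqnorm big1// => i _; rewrite mxE expr0n.
    rewrite (_ : f^~ 0 = cst 0%E); last first.
      apply/funext => N; rewrite /f /Pot /h s0 !mul0r.
      by rewrite /Num.min ltr0n/= mulr0.
    by rewrite s0 invr0 mul0r mulr0; apply: (cvg_limn_einf_sup _).1; exact: cvg_cst.
  apply: (cvg_limn_einf_sup _).1.
  have s0 := sqnorm_gt0 x0; have sn0 := lt0r_neq0 s0.
  have cvE : eps N ^+ 2 @[N --> \oo] --> (0 : R).
    have ce : eps N @[N --> \oo] --> D * 0.
      by apply: cvgM; [exact: cvg_cst|exact: cvg_harmonic].
    have := cvgM ce ce; rewrite mulr0 mulr0.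
    by apply.
  have cvz : sqnorm x + eps N ^+ 2 @[N --> \oo] --> sqnorm x.
    by rewrite -[X in _ --> X]addr0; apply: cvgD => //; exact: cvg_cst.
  have lpx : logpos rho m (sqnorm x).
    apply: logposW mk _; apply: logpos_tower => //.
    by rewrite (le_trans (WD _ Wx))// ler_peMl ?sqr_ge0// ler1n.
  have ch : {for sqnorm x, continuous (h (sqnorm x))}.
    have c2 : (t ^+ 2 @[t --> sqnorm x] --> sqnorm x ^+ 2) by exact: exprn_continuous.
    apply: cvgM; first apply: cvgM; first exact: cvg_cst.
      by apply: cvgV => //; rewrite expf_neq0.
    apply: cvgD; first exact: cvg_cst.
    apply: cvgM; last exact: cvg_cst.
    exact: continuous_logsum2.
  have cvh : h (sqnorm x) (sqnorm x + eps N ^+ 2) @[N --> \oo] --> h (sqnorm x) (sqnorm x).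
    exact: (continuous_cvg _ ch cvz).
  apply: cvg_EFin; first exact: nearW.
  apply: cvgM; first exact: cvg_cst.
  rewrite (_ : _^-1 * _ = h (sqnorm x) (sqnorm x)); last by rewrite /h; field.
  (* The regularised potential is eventually below its limit plus 1, hence below N + 1, and the
     truncation is no longer active. *)
  apply: (cvg_trans _ cvh); apply: near_eq_cvg; near=> N.
  rewrite /Pot min_l//; apply: (@le_trans _ _ (h (sqnorm x) (sqnorm x) + 1)).
    by near: N; apply: (cvgr_le _ cvh); rewrite ltrDl.
  rewrite -natr1 lerD2r; near: N; exact: nbhs_infty_ger.
move=> H; apply: (le_trans H); rewrite limn_einf_lim.
apply: lime_le; first exact: is_cvg_einfs.
apply: nearW => N; apply: le_trans (fG N).
by apply: ereal_inf_lbound; exists N => /=.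
Unshelve. all: by end_near. Qed.

End hardy_improved.

(** * Smooth trial functions *)

Lemma is_derive_expn {R : realType} {V : normedModType R} (f : V -> R) (x v : V)
    (k : nat) (a : R) : is_derive x v f a ->
  is_derive x v (fun y => f y ^+ k) (k%:R * f x ^+ k.-1 * a).
Proof.
move=> df; elim: k => [|k IHk].
  by rewrite !mul0r; under eq_fun do rewrite expr0; exact: is_derive_cst.
under eq_fun do rewrite exprS.
apply: (@is_derive_eq _ _ _ _ _ _ _ _ (is_derive_mul df IHk)).
case: k {IHk} => [|k]; first by rewrite expr0; ring.
by rewrite /= -[in RHS]natr1 exprS; ring.
Qed.

(** * A smooth bump with a one-sided bound on its second derivative *)

Section bump.
Context {R : realType}.
Implicit Types (t : R) (j : nat).

(** The powers of 1/t are carried along so that the derivatives stay in the linear span of the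
    family. *)
Definition eta j t : R := if 0 < t then t ^- j * expR (- t^-1) else 0.

Lemma eta_ge0 j t : 0 <= eta j t.
Proof.
rewrite /eta; case: ifP => // t0.
by rewrite mulr_ge0 ?expR_ge0// invr_ge0 exprn_ge0// ltW.
Qed.

Lemma eta_gt0 j t : 0 < t -> 0 < eta j t.
Proof.
by move=> t0; rewrite /eta t0 mulr_gt0 ?expR_gt0// invr_gt0 exprn_gt0.
Qed.

Lemma eta_eq0 j t : t <= 0 -> eta j t = 0.
Proof. by rewrite /eta ltNge => ->. Qed.

(** One term of the exponential series, e^y >= y^(j+1) / (j+1)! at y = 1/t, beats the power t^(-j)
    with a factor t to spare; this gives continuity at 0. *)
Lemma eta_le j t : eta j t <= j.+1`!%:R * `|t|.
Proof.
rewrite /eta; case: ifPn => [t0|_]; last by rewrite mulr_ge0.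
have ti0 : 0 <= t^-1 by rewrite invr_ge0 ltW.
have f0 : 0 < j.+1`!%:R :> R by rewrite ltr0n fact_gt0.
have H : t ^- j.+1 / j.+1`!%:R <= expR t^-1.
  by rewrite -exprVn (le_trans _ (expR_ge1Dxn j ti0))// lerDr.
rewrite expRN gtr0_norm// ler_pdivrMr ?expR_gt0//.
have tn : t ^- j = t * t ^- j.+1 by rewrite exprS invfM mulrA mulfV ?mul1r// lt0r_neq0.
rewrite tn mulrAC mulrC ler_wpM2r ?(ltW t0)//.
by rewrite -ler_pdivrMl// mulrC.
Qed.

Lemma is_derive_eta_neq0 j t : t != 0 ->
  is_derive t 1 (eta j) (eta j.+2 t - j%:R * eta j.+1 t).
Proof.
move=> tn0; have [t0|t0] := ltP 0 t; last first.
  have tl : t < 0 by rewrite lt_neqAle tn0.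
  rewrite !eta_eq0// mulr0 subr0.
  apply: (@near_eq_is_derive _ _ _ (cst 0)).
    have : \forall s \near t, s < 0 by exact: lt_nbhsl.
    by apply: filterS => s s0; rewrite eta_eq0// ltW.
have dV := is_derive_inv tn0 (is_derive_id t (1 : R)).
have dX : is_derive t 1 (fun s : R => s ^+ j) (j%:R * t ^+ j.-1).
  by have := is_derive_expn j (is_derive_id t (1 : R)); rewrite mulr1.
have dXV := @is_derive_inv _ _ (fun s : R => s ^+ j) t 1 _ (expf_neq0 j tn0) dX.
have dE := is_derive_chain (is_derive_mul (is_derive_cst (-1 : R) t 1) dV) (is_derive_expR _).
apply: (@near_eq_is_derive R R^o R^o (fun s : R => s ^- j * expR (-1 * s^-1)) (eta j) t 1).
  have : \forall s \near t, 0 < s by exact: lt_nbhsr.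
  by apply: filterS => s s0; rewrite /eta s0 mulN1r.
apply: (@is_derive_eq _ _ _ _ _ _ _ _ (is_derive_mul dXV dE)).
rewrite /eta t0 /cst/= mulN1r.
case: j {dX dXV} => [|j]; first by rewrite !mul0r ?mulr0; field.
by rewrite !exprS /=; field; rewrite expf_neq0.
Qed.

Lemma continuous_eta0 j : {for 0, continuous (eta j)}.
Proof.
rewrite /prop_for /continuous_at eta_eq0//.
apply: (@squeeze_cvgr _ _ _ _ (cst 0) (fun t => j.+1`!%:R * `|t|)).
- by apply: nearW => t; rewrite eta_ge0 eta_le.
- exact: cvg_cst.
- have n0 : `|t| @[t --> (0 : R)] --> (0 : R).
    by rewrite -[X in _ --> X](normr0 R); exact: (@norm_continuous R R^o).
  have := @cvgMl_tmp _ _ _ _ _ (j.+1`!%:R : R) _ n0; rewrite mulr0.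
  by apply.
Qed.

(** At 0 the difference quotient eta_j(h) / h equals eta_(j+1)(h) on both sides, so
    differentiability there reduces to continuity of the next member of the family. *)
Lemma is_derive_eta j t :
  is_derive t 1 (eta j) (eta j.+2 t - j%:R * eta j.+1 t).
Proof.
have [->|] := eqVneq t 0; last exact: is_derive_eta_neq0.
rewrite !eta_eq0// mulr0 subr0.
have E : (fun h : R => h^-1 *: ((eta j \o shift 0) (h *: (1 : R^o)) - eta j 0)) @ 0^' --> (0 : R).
  have := @continuous_eta0 j.+1; rewrite /prop_for /continuous_at eta_eq0// => c.
  apply: (@cvg_trans _ (eta j.+1 @ 0^')); last first.
    exact: (cvg_trans (cvg_app _ (@nbhs_dnbhs _ _)) c).
  apply: near_eq_cvg; near=> h => /=.
  have h0 : h != 0 by near: h; exact: nbhs_dnbhs_neq.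
  rewrite addr0 [h%:A]mulr1 (eta_eq0 j (lexx 0)) subr0 /eta /GRing.scale/=.
  by case: ifP => _; rewrite ?mulr0// exprS invfM mulrA.
split; first by apply/cvg_ex; eexists; exact: E.
by apply/cvg_lim.
Unshelve. all: by end_near. Qed.

(** On (0, 1) this is exp(- 1/t - 1/(1-t)). It is flat at both ends, and there its second derivative
    is large and positive relative to it, so - b''/b remains bounded above. *)
Definition bump0 t : R := eta 0 t * eta 0 (1 - t).
Definition bump1 t : R := eta 2 t * eta 0 (1 - t) - eta 0 t * eta 2 (1 - t).
Definition bump2 t : R := (eta 4 t - 2 * eta 3 t) * eta 0 (1 - t)
  - 2 * eta 2 t * eta 2 (1 - t) + eta 0 t * (eta 4 (1 - t) - 2 * eta 3 (1 - t)).

Lemma is_derive_etaN j t : is_derive t 1 (fun s => eta j (1 - s))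
  (- (eta j.+2 (1 - t) - j%:R * eta j.+1 (1 - t))).
Proof.
have d1 : is_derive t 1 (fun s : R => 1 - s) (-1).
  have := is_derive_add (is_derive_cst (1 : R) t 1) (is_deriveNid t (1 : R)).
  by rewrite add0r.
apply: (@is_derive_eq _ _ _ _ _ _ _ _ (is_derive_chain d1 (is_derive_eta j (1 - t)))).
by rewrite mulrN1.
Qed.

Lemma is_derive_bump0 t : is_derive t 1 bump0 (bump1 t).
Proof.
apply: (@is_derive_eq _ _ _ _ _ _ _ _
  (is_derive_mul (is_derive_eta 0 t) (is_derive_etaN 0 t))).
by rewrite /bump1; ring.
Qed.

Lemma is_derive_bump1 t : is_derive t 1 bump1 (bump2 t).
Proof.
have d1 := is_derive_mul (is_derive_eta 2 t) (is_derive_etaN 0 t).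
have d2 := is_derive_mul (is_derive_eta 0 t) (is_derive_etaN 2 t).
have d3 := is_derive_mul (is_derive_cst (-1 : R) t 1) d2.
rewrite (_ : bump1 = fun t => eta 2 t * eta 0 (1 - t) + -1 * (eta 0 t * eta 2 (1 - t))); last first.
  by apply/funext => s; rewrite mulN1r.
apply: (@is_derive_eq _ _ _ _ _ _ _ _ (is_derive_add d1 d3)).
by rewrite /bump2 /cst/=; ring.
Qed.

Lemma bump0_ge0 t : 0 <= bump0 t.
Proof. by rewrite mulr_ge0 ?eta_ge0. Qed.

Lemma bump0_neq0 t : bump0 t != 0 -> 0 < t < 1.
Proof.
rewrite /bump0 mulf_eq0 negb_or => /andP[a b].
rewrite !ltNge; apply/andP; split; apply/negP => H.
  by move: a; rewrite eta_eq0 ?eqxx.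
by move: b; rewrite eta_eq0 ?eqxx// subr_le0.
Qed.

(* With [x = 1/t], [y = 1/(1-t)] and [p = x + y = x * y >= 4], the quotient
   [bump2 t / bump0 t] is [p^2 (p^2 - 6 p + 6)], which is at least -32. *)
Lemma bump2_ge t : - 32 * bump0 t <= bump2 t.
Proof.
have [t0|t0] := leP t 0; first by rewrite /bump0 /bump2 !(eta_eq0 _ t0) !(mul0r, mulr0, subr0, addr0).
have [t1|t1] := leP 1 t.
  have t1' : 1 - t <= 0 by rewrite subr_le0.
  by rewrite /bump0 /bump2 !(eta_eq0 _ t1') !(mul0r, mulr0, subr0, addr0).
rewrite /bump0 /bump2 /eta t0 subr_gt0 t1.
have e1 := expR_gt0 (- t^-1); have e2 := expR_gt0 (- (1 - t)^-1).
set a := expR _ in e1 *; set b := expR _ in e2 *.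
pose x := t^-1; pose y := (1 - t)^-1.
have tn0 : t != 0 by rewrite lt0r_neq0.
have tn1 : 1 - t != 0 by rewrite subr_eq0 gt_eqF.
have x0 : 0 < x by rewrite invr_gt0.
have y0 : 0 < y by rewrite invr_gt0 subr_gt0.
have xy : x * y = x + y by rewrite /x /y; field; rewrite tn0 tn1.
rewrite -!exprVn -/x -/y -subr_ge0.
set p := x + y in xy.
have p4 : 4 <= p.
  have p0 : 0 < p by rewrite addr_gt0.
  have : 4 * p <= p ^+ 2.
    have E : p ^+ 2 - 4 * p = (x - y) ^+ 2 by rewrite -[in 4 * p]xy /p; ring.
    by rewrite -subr_ge0 E sqr_ge0.
  by rewrite expr2 ler_pM2r.
rewrite [X in 0 <= X](_ : _ =
    ((p ^+ 2 - 4 * (x * y)) * p ^+ 2 - 2 * (p ^+ 3 - 3 * (x * y) * p) + 32) * (a * b)); last first.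
  by rewrite /p; ring.
rewrite xy mulr_ge0 ?mulr_ge0 ?(ltW e1) ?(ltW e2)//.
have -> : (p ^+ 2 - 4 * p) * p ^+ 2 - 2 * (p ^+ 3 - 3 * p * p) + 32 =
    (p - 4) * (p ^+ 2 * (p - 4) + 2 * p * (p - 4) + 6 * (p - 4) + 16) by ring.
have p40 : 0 <= p - 4 by rewrite subr_ge0.
by rewrite mulr_ge0// !addr_ge0 ?mulr_ge0 ?sqr_ge0//; lra.
Qed.

End bump.

(** * Extension by zero of functions that are smooth on an open set *)

Section smooth_extension.
Context {R : realType} {n : nat}.
Implicit Types (U K W : set 'rV[R]_n) (f g : 'rV[R]_n -> R).

(** The open sets [U] and the complement of [K] cover the space: near a point the extension is
    either [f] or identically 0. Derivatives and continuity are local, so these two cases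
    suffice. *)
Lemma patch_near U K f x : open U -> closed K -> K `<=` U ->
  (forall y, U y -> ~ K y -> f y = 0) ->
  (U x /\ \forall y \near x, f y = (f \_ U) y) \/
  (~ K x /\ \forall y \near x, 0 = (f \_ U) y).
Proof.
move=> oU cK KU f0; have [Ux|nUx] := pselect (U x); [left|right].
  split=> //; have : nbhs x U by exact: open_nbhs_nbhs.
  by apply: filterS => y Uy; rewrite patchE mem_set.
have nKx : ~ K x by move=> /KU.
split=> //; have : nbhs x (~` K) by apply: open_nbhs_nbhs; split=> //; rewrite openC.
apply: filterS => y Ky; rewrite patchE; case: ifP => //; rewrite inE => Uy.
by rewrite f0.
Qed.

Lemma partial_patch U K f g i : open U -> closed K -> K `<=` U ->
  (forall y, U y -> ~ K y -> f y = 0) ->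
  (forall x, U x -> is_derive x (delta_mx 0 i) f (g x)) ->
  (forall y, U y -> ~ K y -> g y = 0) /\
  (forall x, is_derive x (delta_mx 0 i) (f \_ U) ((g \_ U) x)).
Proof.
move=> oU cK KU f0 fg; split=> [x Ux Kx|x].
  apply: is_derive_near0 (fg x Ux) _.
  have : nbhs x (U `&` ~` K).
    apply: open_nbhs_nbhs; split=> //; apply: openI => //; by rewrite openC.
  by apply: filterS => y [Uy Ky]; exact: f0.
have [[Ux nx]|[Kx nx]] := patch_near x oU cK KU f0.
  by apply: near_eq_is_derive nx _; rewrite patchE mem_set//; exact: fg.
have g0 : (g \_ U) x = 0.
  rewrite patchE; case: ifP => //; rewrite inE => Ux.
  apply: is_derive_near0 (fg x Ux) _.
  have : nbhs x (U `&` ~` K).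
    apply: open_nbhs_nbhs; split=> //; apply: openI => //; by rewrite openC.
  by apply: filterS => y [Uy Ky]; exact: f0.
rewrite g0; apply: (@near_eq_is_derive _ _ _ (cst 0)) => //.
Qed.

Lemma continuous_patch U K f : open U -> closed K -> K `<=` U ->
  (forall y, U y -> ~ K y -> f y = 0) ->
  (forall x, U x -> {for x, continuous f}) -> continuous (f \_ U).
Proof.
move=> oU cK KU f0 cf x.
have [[Ux nx]|[Kx nx]] := patch_near x oU cK KU f0.
  exact: near_eq_continuous_at nx (cf x Ux).
by apply: (@near_eq_continuous_at _ _ (cst 0)) nx _; exact: cst_continuous.
Qed.

(** [smooth] quantifies over all sequences of partial derivatives. With a class [A] stable under
    them on [U], induction on the sequence shows that each iterated derivative of the extension is
    again the extension by zero of a member of [A]. *)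
Lemma smooth_patch U K (A : ('rV[R]_n -> R) -> Prop) f :
  open U -> closed K -> K `<=` U ->
  (forall g, A g -> forall x, U x -> {for x, continuous g}) ->
  (forall g i, A g -> exists g', A g' /\
     forall x, U x -> is_derive x (delta_mx 0 i) g (g' x)) ->
  A f -> (forall y, U y -> ~ K y -> f y = 0) -> smooth (f \_ U).
Proof.
move=> oU cK KU cA dA Af f0 s.
have [g [Ag g0 ->]] : exists g, [/\ A g, forall y, U y -> ~ K y -> g y = 0 &
    foldr partial (f \_ U) s = g \_ U].
  elim: s => [|i s [g [Ag g0 /= ->]]]; first by exists f.
  have [g' [Ag' gg']] := dA g i Ag.
  have [g'0 dg'] := partial_patch oU cK KU g0 gg'.
  by exists g'; split=> //; apply/funext => x; case: (dg' x).
split; first exact: continuous_patch oU cK KU g0 (cA _ Ag).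
move=> i x; have [g' [_ gg']] := dA g i Ag.
by have [_ /(_ x)[]] := partial_patch oU cK KU g0 gg'.
Qed.

Lemma test_function_patch W U K f : open U -> compact K -> K `<=` U -> U `<=` W ->
  (forall y, U y -> ~ K y -> f y = 0) -> smooth (f \_ U) ->
  test_function W (f \_ U).
Proof.
move=> oU cptK KU UW f0 sf.
have cK : closed K by apply: compact_closed => //; exact: norm_hausdorff.
have sK : closure [set x | (f \_ U) x != 0] `<=` K.
  rewrite closureE; apply: smallest_sub => // x /=.
  rewrite patchE; case: ifP; rewrite ?eqxx// inE => Ux fx.
  by apply: contrapT => Kx; move: fx; rewrite f0// eqxx.
split=> //; first by apply: subclosed_compact cptK sK; exact: closed_closure.
by move=> x /sK/KU/UW.
Qed.

End smooth_extension.

(** * The radial trial function and its Laplacian *)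

Section trial_function.
Context {R : realType} {n : nat}.
Variables (rho : R) (m : nat) (delta : R).

(** Half of the exponent (n-2)/2, because the argument is |x|^2. *)
Let kap : R := (n%:R - 2) / 4.

(* [weight s = s^(-kap) * sqrt (logprod m s)], since [ln (ell i s) = ell i.+1 s]. *)
Definition weight (s : R) : R :=
  expR (- kap * ln s + 2^-1 * \sum_(1 <= i < m.+1) ell rho i.+1 s).

Lemma is_derive_weight s : logpos rho m s ->
  is_derive s 1 weight (- weight s * (kap + logsum rho m s / 4) / s).
Proof.
move=> H; have [_ s0 _] := H; have sn0 := lt0r_neq0 s0.
have d1 := is_derive_mul (is_derive_cst (- kap) s 1) (is_derive1_ln s0).
have d2 : is_derive s 1 (fun t => \sum_(1 <= i < m.+1) ell rho i.+1 t)
    (\sum_(1 <= i < m.+1) - (2 * s * logprod rho i s)^-1).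
  apply: is_derive_sum_nat => j; rewrite ltnS => /andP[_ jm].
  by apply: is_derive_ell; exact: logposW H.
have d3 := is_derive_mul (is_derive_cst (2^-1 : R) s 1) d2.
apply: (@is_derive_eq _ _ _ _ _ _ _ _
  (is_derive_chain (is_derive_add d1 d3) (is_derive_expR _))).
have -> : \sum_(1 <= i < m.+1) - (2 * s * logprod rho i s)^-1 =
    - (2 * s)^-1 * logsum rho m s.
  by rewrite /logsum mulr_sumr; apply: eq_bigr => i _; rewrite invfM mulNr.
rewrite /cst/= -/(weight s) mul0r add0r mul0r add0r; field.
exact: sn0.
Qed.

(** The affine change of variable that takes the interval from 1/delta to 2/delta, in the variable L
    (m+1), onto the support [0, 1] of the bump. *)
Definition phase (s : R) : R := -1 + delta * ell rho m.+1 s.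

Lemma is_derive_phase s : logpos rho m s ->
  is_derive s 1 phase (- delta / (2 * s * logprod rho m s)).
Proof.
move=> H; have d := is_derive_add (is_derive_cst (-1 : R) s 1)
  (is_derive_mul (is_derive_cst delta s 1) (is_derive_ell H)).
apply: (@is_derive_eq _ _ _ _ _ _ _ _ d).
by rewrite /cst/= mul0r !add0r mulrN mulNr.
Qed.

Definition trial (s : R) : R := weight s * bump0 (phase s).
Definition trial1 (s : R) : R := - (weight s / s) *
  ((kap + logsum rho m s / 4) * bump0 (phase s)
   + bump1 (phase s) * delta / (2 * logprod rho m s)).
Definition trial2 (s : R) : R :=
  let P := logprod rho m s in let S := logsum rho m s in
  let A := kap + S / 4 in
  weight s / s ^+ 2 *
  ((A + 1) * (A * bump0 (phase s) + bump1 (phase s) * delta / (2 * P))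
   - (S ^+ 2 + logsum2 rho m s) / 16 * bump0 (phase s)
   + A * bump1 (phase s) * delta / (2 * P)
   + bump2 (phase s) * delta ^+ 2 / (4 * P ^+ 2)
   - bump1 (phase s) * delta * S / (4 * P)).

Lemma is_derive_trial s : logpos rho m s -> is_derive s 1 trial (trial1 s).
Proof.
move=> H; have [_ s0 _] := H; have sn0 := lt0r_neq0 s0.
have p0 := lt0r_neq0 (logprod_gt0 H).
have d := is_derive_mul (is_derive_weight H)
  (is_derive_chain (is_derive_phase H) (is_derive_bump0 _)).
apply: (@is_derive_eq _ _ _ _ _ _ _ _ d).
by rewrite /trial1; field; rewrite sn0 p0.
Qed.

Lemma is_derive_trial1 s : logpos rho m s -> is_derive s 1 trial1 (trial2 s).
Proof.
move=> H; have [_ s0 _] := H; have sn0 := lt0r_neq0 s0.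
have p0 := lt0r_neq0 (logprod_gt0 H).
have p20 : 2 * logprod rho m s != 0 by rewrite mulf_neq0.
have dinv := is_derive_inv sn0 (is_derive_id s (1 : R)).
have dw := is_derive_mul (is_derive_mul (is_derive_cst (-1 : R) s 1) (is_derive_weight H)) dinv.
have dA := is_derive_add (is_derive_cst kap s 1)
  (is_derive_mul (is_derive_logsum H) (is_derive_cst (4^-1 : R) s 1)).
have db0 := is_derive_chain (is_derive_phase H) (is_derive_bump0 _).
have db1 := is_derive_chain (is_derive_phase H) (is_derive_bump1 _).
have dP := @is_derive_inv _ _ (fun t => 2 * logprod rho m t) s 1 _ p20
  (is_derive_mul (is_derive_cst (2 : R) s 1) (is_derive_logprod H)).
have d := is_derive_mul dw (is_derive_add (is_derive_mul dA db0)
  (is_derive_mul (is_derive_mul db1 (is_derive_cst delta s 1)) dP)).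
rewrite (_ : trial1 = fun t => -1 * weight t * t^-1 *
  ((kap + logsum rho m t * 4^-1) * bump0 (phase t) +
   bump1 (phase t) * delta * (2 * logprod rho m t)^-1)); last first.
  by apply/funext => t; rewrite /trial1 mulN1r mulNr.
apply: (@is_derive_eq _ _ _ _ _ _ _ _ d).
by rewrite /trial2 /cst/=; field; rewrite sn0 p0.
Qed.

(* The left-hand side is the Laplacian of [trial (|x|^2)]; the terms of first
   order in the bump cancel. *)
Lemma trial_laplacian s : logpos rho m s ->
  2 * n%:R * trial1 s + 4 * s * trial2 s =
  - (weight s / s) * ((((n%:R - 2) / 2) ^+ 2 + logsum2 rho m s / 4) * bump0 (phase s)
     - delta ^+ 2 * bump2 (phase s) / logprod rho m s ^+ 2).
Proof.
move=> H; have [_ s0 _] := H; have sn0 := lt0r_neq0 s0.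
have p0 := lt0r_neq0 (logprod_gt0 H).
rewrite /trial1 /trial2.
have -> : n%:R = 4 * kap + 2 :> R by rewrite /kap; field.
by field; rewrite sn0 p0.
Qed.

(* A class of functions closed under partial derivatives where [logpos] holds. *)
Inductive smooth_expr : ('rV[R]_n -> R) -> Prop :=
| SE_cst c : smooth_expr (fun=> c)
| SE_coord i : smooth_expr (fun x => x 0 i)
| SE_add f g : smooth_expr f -> smooth_expr g -> smooth_expr (fun x => f x + g x)
| SE_mul f g : smooth_expr f -> smooth_expr g -> smooth_expr (fun x => f x * g x)
| SE_inv : smooth_expr (fun x => (sqnorm x)^-1)
| SE_ell i : (i < m)%N -> smooth_expr (fun x => (ell rho i.+1 (sqnorm x))^-1)
| SE_weight : smooth_expr (fun x => weight (sqnorm x))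
| SE_eta j : smooth_expr (fun x => eta j (phase (sqnorm x)))
| SE_etaN j : smooth_expr (fun x => eta j (1 - phase (sqnorm x))).

Lemma smooth_expr_logprod j : (j <= m)%N ->
  smooth_expr (fun x => (logprod rho j (sqnorm x))^-1).
Proof.
elim: j => [|j IHj] jm.
  by under eq_fun do rewrite logprod0; exact: SE_cst.
under eq_fun do rewrite logprodS invfM.
by apply: SE_mul; [apply: IHj; exact: ltnW|exact: SE_ell].
Qed.

Lemma smooth_expr_sum (F : nat -> 'rV[R]_n -> R) p q :
  (forall j, (p <= j < q)%N -> smooth_expr (F j)) ->
  smooth_expr (fun x => \sum_(p <= j < q) F j x).
Proof.
elim: q => [|q IHq] H.
  by under eq_fun do rewrite big_geq//; exact: SE_cst.
have [pq|qp] := leqP p q; last first.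
  by under eq_fun do rewrite big_geq//; exact: SE_cst.
under eq_fun do rewrite big_nat_recr//=.
apply: SE_add; last by apply: H; rewrite pq/=.
by apply: IHq => j /andP[pj jq]; apply: H; rewrite pj ltnS ltnW.
Qed.

Lemma smooth_expr_logsum : smooth_expr (fun x => logsum rho m (sqnorm x)).
Proof.
apply: smooth_expr_sum => j; rewrite ltnS => /andP[_ jm].
exact: smooth_expr_logprod.
Qed.

Lemma smooth_expr_partial (f : 'rV[R]_n -> R) (i : 'I_n) : smooth_expr f ->
  exists g, smooth_expr g /\ forall x, logpos rho m (sqnorm x) ->
    is_derive x (delta_mx 0 i) f (g x).
Proof.
(* For a radial generator only the one-variable derivative has to be recognised in the class; the
   chain rule adds the factor 2 x_i, a constant times a coordinate. *)
have radial (h dh : R -> R) : smooth_expr (fun x => dh (sqnorm x)) ->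
    (forall s, logpos rho m s -> is_derive s 1 h (dh s)) ->
    exists g, smooth_expr g /\ forall x, logpos rho m (sqnorm x) ->
      is_derive x (delta_mx 0 i) (fun x => h (sqnorm x)) (g x).
  move=> sdh dhP; exists (fun x => dh (sqnorm x) * (2 * x 0 i)); split.
    by apply: SE_mul => //; apply: SE_mul; [exact: SE_cst|exact: SE_coord].
  by move=> x H; apply: is_derive_chain (dhP _ H); exact: is_derive_sqnorm.
have s1 c f0 : smooth_expr f0 -> smooth_expr (fun x => c * f0 x).
  by move=> sf; apply: SE_mul => //; exact: SE_cst.
elim.
- by move=> c; exists (fun=> 0); split=> [|x _]; [exact: SE_cst|exact: is_derive_cst].
- by move=> j; exists (fun=> (j == i)%:R); split=> [|x _]; [exact: SE_cst|exact: is_derive_coord].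
- move=> f1 f2 sf1 [g1 [sg1 dg1]] sf2 [g2 [sg2 dg2]].
  exists (fun x => g1 x + g2 x); split=> [|x H]; first exact: SE_add.
  exact: is_derive_add (dg1 x H) (dg2 x H).
- move=> f1 f2 sf1 [g1 [sg1 dg1]] sf2 [g2 [sg2 dg2]].
  exists (fun x => g1 x * f2 x + f1 x * g2 x); split=> [|x H].
    by apply: SE_add; exact: SE_mul.
  exact: is_derive_mul (dg1 x H) (dg2 x H).
- apply: (radial (fun s => s^-1) (fun s => -1 * (s^-1 * s^-1))).
    by apply: (s1 _ _ _); apply: SE_mul; exact: SE_inv.
  move=> s [_ s0 _]; have sn0 := lt0r_neq0 s0.
  apply: (@is_derive_eq _ _ _ _ _ _ _ _ (is_derive_inv sn0 (is_derive_id s (1 : R)))).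
  by field.
- move=> j jm.
  apply: (radial (fun s => (ell rho j.+1 s)^-1)
    (fun s => 2^-1 * (s^-1 * ((logprod rho j s)^-1 * ((ell rho j.+1 s)^-1 * (ell rho j.+1 s)^-1))))).
    apply: (s1 _ _ _); apply: SE_mul; first exact: SE_inv.
    apply: SE_mul; first by apply: smooth_expr_logprod; exact: ltnW.
    by apply: SE_mul; exact: SE_ell.
  move=> s H; have [_ s0 Hi] := H; have sn0 := lt0r_neq0 s0.
  have Hj := logposW (ltnW jm) H.
  have p0 := lt0r_neq0 (logprod_gt0 Hj).
  have e0 : ell rho j.+1 s != 0 by rewrite lt0r_neq0// Hi.
  apply: (@is_derive_eq _ _ _ _ _ _ _ _ (is_derive_inv e0 (is_derive_ell Hj))).
  by field; rewrite sn0 p0 e0.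
- apply: (radial weight (fun s => -1 * (weight s * ((kap + 4^-1 * logsum rho m s) * s^-1)))).
    apply: (s1 _ _ _); apply: SE_mul; first exact: SE_weight.
    apply: SE_mul; last exact: SE_inv.
    by apply: SE_add; [exact: SE_cst|apply: (s1 _ _ _); exact: smooth_expr_logsum].
  move=> s H; have [_ s0 Hi] := H; have sn0 := lt0r_neq0 s0.
  apply: (@is_derive_eq _ _ _ _ _ _ _ _ (is_derive_weight H)).
  by field.
- move=> j.
  apply: (radial (fun s => eta j (phase s))
    (fun s => (eta j.+2 (phase s) + (- j%:R) * eta j.+1 (phase s))
     * ((- delta / 2) * (s^-1 * (logprod rho m s)^-1)))).
    apply: SE_mul; first by apply: SE_add; [exact: SE_eta|apply: (s1 _ _ _); exact: SE_eta].
    by apply: (s1 _ _ _); apply: SE_mul; [exact: SE_inv|exact: smooth_expr_logprod].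
  move=> s H; have [_ s0 Hi] := H; have sn0 := lt0r_neq0 s0.
  have p0 := lt0r_neq0 (logprod_gt0 H).
  apply: (@is_derive_eq _ _ _ _ _ _ _ _ (is_derive_chain (is_derive_phase H) (is_derive_eta j _))).
  by field; rewrite sn0 p0.
- move=> j.
  apply: (radial (fun s => eta j (1 - phase s))
    (fun s => (eta j.+2 (1 - phase s) + (- j%:R) * eta j.+1 (1 - phase s))
     * ((delta / 2) * (s^-1 * (logprod rho m s)^-1)))).
    apply: SE_mul; first by apply: SE_add; [exact: SE_etaN|apply: (s1 _ _ _); exact: SE_etaN].
    by apply: (s1 _ _ _); apply: SE_mul; [exact: SE_inv|exact: smooth_expr_logprod].
  move=> s H; have [_ s0 Hi] := H; have sn0 := lt0r_neq0 s0.
  have p0 := lt0r_neq0 (logprod_gt0 H).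
  apply: (@is_derive_eq _ _ _ _ _ _ _ _
    (@is_derive_chain _ _ phase (fun t => eta j (1 - t)) _ _ _ _
      (is_derive_phase H) (is_derive_etaN j _))).
  by field; rewrite sn0 p0.
Qed.

Lemma smooth_expr_continuous (f : 'rV[R]_n -> R) x : smooth_expr f ->
  logpos rho m (sqnorm x) -> {for x, continuous f}.
Proof.
move=> sf H.
have radial (h : R -> R) d : is_derive (sqnorm x) 1 h d ->
    {for x, continuous (fun x => h (sqnorm x))}.
  move=> dh; apply: for_continuous_comp; first exact: continuous_sqnorm.
  exact: is_derive_continuous dh.
have [_ s0 Hi] := H; have sn0 := lt0r_neq0 s0.
elim: sf.
- by move=> c; exact: cst_continuous.
- by move=> i; exact: for_continuous_coord.
- by move=> f1 f2 _ c1 _ c2; exact: for_continuousD.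
- by move=> f1 f2 _ c1 _ c2; exact: for_continuousM.
- exact (radial _ _ (@is_derive_inv _ _ id _ _ _ sn0 (is_derive_id _ (1 : R)))).
- move=> j jm; have Hj := logposW (ltnW jm) H.
  have e0 : ell rho j.+1 (sqnorm x) != 0 by rewrite lt0r_neq0// Hi.
  exact (radial _ _ (@is_derive_inv _ _ (ell rho j.+1) _ _ _ e0 (is_derive_ell Hj))).
- exact (radial _ _ (is_derive_weight H)).
- move=> j; exact (radial _ _ (@is_derive_chain _ _ phase (eta j) _ _ _ _
    (is_derive_phase H) (is_derive_eta j _))).
- move=> j; exact (radial _ _ (@is_derive_chain _ _ phase (fun t => eta j (1 - t)) _ _ _ _
    (is_derive_phase H) (is_derive_etaN j _))).
Qed.

Lemma smooth_expr_trial : smooth_expr (fun x => trial (sqnorm x)).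
Proof.
by apply: SE_mul; [exact: SE_weight|apply: SE_mul; [exact: SE_eta|exact: SE_etaN]].
Qed.

End trial_function.

(** * The quotient and its infimum *)

Section weights.
Context {R : realType} {n : nat}.
Implicit Types (W : set 'rV[R]_n) (u : 'rV[R]_n -> R).

Lemma measurable_invr : measurable_fun [set: R] (fun t : R => t^-1).
Proof.
have -> : [set: R] = [set 0] `|` [set t : R | t != 0].
  by apply/seteqP; split=> // t _; have [->|] := eqVneq t 0; [left|right].
have oN : open [set t : R | t != 0] by exact: (@open_neq R R^o).
apply/measurable_funU => //; first exact: open_measurable.
split; first exact: measurable_fun_set1.
apply: open_continuous_measurable_fun => // t; rewrite inE => /= t0.
exact: inv_continuous.
Qed.

Lemma measurable_ell (rho : R) i : measurable_fun [set: R] (ell rho i).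
Proof.
elim: i => [|i IHi]; last first.
  rewrite (_ : ell rho i.+1 = @ln R \o ell rho i)//.
  by apply: measurableT_comp => //; exact: measurable_ln.
rewrite (_ : ell rho 0 = (fun t => rho * t^-1) \o (@Num.sqrt R))//.
apply: measurableT_comp; last first.
  by apply: continuous_measurable_fun; exact: sqrt_continuous.
by apply: measurable_funM => //; exact: measurable_invr.
Qed.

Lemma measurable_logprod (rho : R) j : measurable_fun [set: R] (logprod rho j).
Proof.
elim: j => [|j IHj].
  by rewrite (_ : logprod rho 0 = cst 1)//; apply/funext => s; rewrite logprod0.
rewrite (_ : logprod rho j.+1 = fun s => logprod rho j s * ell rho j.+1 s).
  by apply: measurable_funM => //; exact: measurable_ell.
by apply/funext => s; rewrite logprodS.
Qed.

(** Index 0 gives the plain Hardy weight 1/|x|^2, so all weighted terms of the quotient have one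
    form. *)
Definition hweight (rho : R) j (x : 'rV[R]_n) : R :=
  (sqnorm x)^-1 * logprod rho j (sqnorm x) ^- 2.

Lemma hweight_ge0 rho j x : 0 <= hweight rho j x.
Proof. by rewrite mulr_ge0 ?invr_ge0 ?sqr_ge0 ?sqnorm_ge0. Qed.

Lemma measurable_hweight (rho : R) j :
  measurable_fun [set: 'rV[R]_n] (hweight rho j : _ -> measurableTypeR R).
Proof.
have ms : measurable_fun [set: 'rV[R]_n] (@sqnorm R n : _ -> measurableTypeR R).
  by apply: continuous_measurable_rV => x; exact: continuous_sqnorm.
apply: measurable_funM; first exact: measurableT_comp measurable_invr ms.
apply: (measurableT_comp measurable_invr); apply: measurable_funX.
exact: measurableT_comp (measurable_logprod rho j) ms.
Qed.

Lemma log_hardyE W (rho : R) j u : log_hardy W rho j u =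
  (\int[lebesgue_rV n]_(x in W) (u x ^+ 2 * hweight rho j x)%:E)%E.
Proof.
apply: eq_integral => x _; congr EFin.
by rewrite /hweight mulrA enorm_sqr.
Qed.

Lemma log_hardy0E W (rho : R) u :
  (\int[lebesgue_rV n]_(x in W) (u x ^+ 2 / enorm x ^+ 2)%:E =
   \int[lebesgue_rV n]_(x in W) (u x ^+ 2 * hweight rho 0 x)%:E)%E.
Proof.
apply: eq_integral => x _; congr EFin.
by rewrite /hweight logprod0 expr1n invr1 mulr1 enorm_sqr.
Qed.

Lemma measurable_u2_hweight W (rho : R) j u : measurable W ->
  measurable_fun W (u : _ -> measurableTypeR R) ->
  measurable_fun W (fun x => u x ^+ 2 * hweight rho j x : measurableTypeR R).
Proof.
move=> mW mu; apply: measurable_funM; first exact: measurable_funX.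
apply: measurable_funTS; exact: measurable_hweight.
Qed.

(** With e = 0 this is the potential of the lower bound, with e > 0 the one that the trial functions
    satisfy. The sum includes the index [m], whose coefficient 1/4 is the constant of the
    theorem. *)
Lemma log_hardy_split W (rho c e : R) m u : measurable W ->
  measurable_fun W (u : _ -> measurableTypeR R) -> 0 <= c -> 0 <= e ->
  (\int[lebesgue_rV n]_(x in W) (u x ^+ 2 * ((sqnorm x)^-1 *
      (c + logsum2 rho m (sqnorm x) / 4 + e * logprod rho m (sqnorm x) ^- 2)))%:E =
   c%:E * \int[lebesgue_rV n]_(x in W) (u x ^+ 2 / enorm x ^+ 2)%:E +
   (4^-1)%:E * \sum_(1 <= j < m.+1) log_hardy W rho j u +
   e%:E * log_hardy W rho m u)%E.
Proof.
move=> mW mu c0 e0.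
pose F j x := (u x ^+ 2 * hweight rho j x)%:E.
have mF j : measurable_fun W (F j).
  by apply/measurable_EFinP; exact: measurable_u2_hweight.
have F0 j x : (0 <= F j x)%E by rewrite lee_fin mulr_ge0 ?sqr_ge0 ?hweight_ge0.
have -> : (\int[lebesgue_rV n]_(x in W) (u x ^+ 2 * ((sqnorm x)^-1 *
      (c + logsum2 rho m (sqnorm x) / 4 + e * logprod rho m (sqnorm x) ^- 2)))%:E =
  \int[lebesgue_rV n]_(x in W) (c%:E * F 0%N x +
    (4^-1)%:E * (\sum_(1 <= j < m.+1) F j x) + e%:E * F m x))%E.
  apply: eq_integral => x _; rewrite /F sumEFin -!EFinM -!EFinD; congr EFin.
  rewrite -mulr_sumr /hweight -mulr_sumr -/(logsum2 rho m (sqnorm x)).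
  by rewrite logprod0 expr1n invr1; ring.
have mS : measurable_fun W (fun x => \sum_(1 <= j < m.+1) F j x)%E.
  by apply: emeasurable_sum => j; exact: mF.
have S0 x : (0 <= \sum_(1 <= j < m.+1) F j x)%E by apply: sume_ge0.
rewrite ge0_integralD//; first last.
- exact: measurable_funeM.
- by move=> x _; rewrite mule_ge0.
- by apply: emeasurable_funD; exact: measurable_funeM.
- by move=> x _; rewrite adde_ge0// mule_ge0.
rewrite ge0_integralD//; first last.
- exact: measurable_funeM.
- by move=> x _; rewrite mule_ge0.
- exact: measurable_funeM.
- by move=> x _; rewrite mule_ge0.
rewrite !ge0_integralZl_EFin// ge0_integral_sum//.
rewrite (log_hardy0E _ rho) log_hardyE; congr (_ + _ * _ + _)%E.
by apply: eq_bigr => j _; rewrite log_hardyE.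
Qed.

Lemma lebesgue_rV_origin : (0 < n)%N -> lebesgue_rV n [set (0 : 'rV[R]_n)] = 0%E.
Proof.
move=> n0; pose i0 := Ordinal n0.
have := @lebesgue_rV_box R n (fun=> [set 0]) (fun=> measurable_set1 _).
rewrite (_ : [set x : 'rV[R]_n | _] = [set 0]); last first.
  apply/seteqP; split=> [x H|x ->] /=; last by move=> i; rewrite mxE.
  by apply/rowP => i; rewrite mxE; exact: H.
by move=> ->; rewrite (bigD1 i0)//= lebesgue_measure_set1 mul0e.
Qed.

Lemma lebesgue_rV_open_gt0 (O : set 'rV[R]_n) x : open O -> O x ->
  (0 < lebesgue_rV n O)%E.
Proof.
move=> oO Ox; have /nbhs_ballP[e /= e0 eO] := oO _ Ox.
pose A i : set (measurableTypeR R) := [set` `](x 0 i - e), (x 0 i + e)[ ].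
have mA i : measurable (A i) by exact: measurable_itv.
pose B := [set y : 'rV[R]_n | forall i, A i (y 0 i)].
have HB : lebesgue_rV n B = _ := lebesgue_rV_box mA.
have BO : B `<=` O.
  move=> y Hy; apply: eO; rewrite -ball_normE /ball_/=; apply/mx_norm_ltP => // i.
  by have := Hy i; rewrite /A/= in_itv/= -ltr_distlC !mxE.
have : (0 < lebesgue_rV n B)%E.
  rewrite HB; elim/big_ind : _ => // [a b a0 b0|i _]; first exact: mule_gt0.
  rewrite lebesgue_measure_itv/= lte_fin ifT; last by rewrite ltrD2l gtrN.
  by rewrite -EFinB lte_fin subr_gt0 ltrD2l gtrN.
move=> H; apply: (lt_le_trans H); apply: le_measure => //; rewrite inE.
  exact: measurable_rV_box.
exact: open_measurable_rV.
Qed.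

(** A nonnegative integrand with zero integral vanishes almost everywhere, and the weight is nonzero
    on [W] except at the origin, a null set. *)
Lemma log_hardy_gt0 W (rho : R) m u : (0 < n)%N -> open W ->
  measurable_fun W (u : _ -> measurableTypeR R) ->
  (forall x, W x -> x != 0 -> logprod rho m (sqnorm x) != 0) ->
  ~ {ae lebesgue_rV n, forall x, W x -> u x = 0} ->
  (0 < log_hardy W rho m u)%E.
Proof.
move=> n0 oW mu lp; have mW : measurable W by exact: open_measurable_rV.
rewrite log_hardyE => H; rewrite lt0e; apply/andP; split; last first.
  by apply: integral_ge0 => x _; rewrite lee_fin mulr_ge0 ?sqr_ge0 ?hweight_ge0.
apply/eqP => I0; apply: H.
pose F x := (u x ^+ 2 * hweight rho m x)%:E.
have mF : measurable_fun W F.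
  by apply/measurable_EFinP; exact: measurable_u2_hweight.
have : (\int[lebesgue_rV n]_(x in W) `|F x| = 0)%E.
  rewrite -I0; apply: eq_integral => x _; rewrite gee0_abs// lee_fin.
  by rewrite mulr_ge0 ?sqr_ge0 ?hweight_ge0.
move=> /(ae_eq_integral_abs (lebesgue_rV n) mW mF).
have : {ae lebesgue_rV n, forall x, x != (0 : 'rV[R]_n)}.
  exists [set 0]; split.
  - rewrite (_ : [set 0] = [set x : 'rV[R]_n | forall i, [set (0 : measurableTypeR R)] (x 0 i)]).
      by apply: (@measurable_rV_box _ n (fun=> [set 0])) => i; exact: measurable_set1.
    apply/seteqP; split=> [x ->|x Hx] /=; first by move=> i; rewrite mxE.
    by apply/rowP => i; rewrite mxE; exact: Hx.
  - exact: lebesgue_rV_origin.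
  - by move=> x /= /negP; rewrite negbK => /eqP.
apply: filterS2 => x x0 + Wx => /(_ Wx) [] /eqP.
rewrite mulf_eq0 sqrf_eq0 => /orP[/eqP//|].
rewrite /hweight mulf_eq0 !invr_eq0 sqrf_eq0 (negPf (lp x Wx x0)) orbF.
by rewrite (gt_eqF (sqnorm_gt0 x0)).
Qed.

Lemma test_function_H10 W u : open W -> test_function W u ->
  sobolevH10 W u (gradient u).
Proof.
move=> oW tu; have [K [cptK KW u0]] := test_functionP tu.
split; last first.
  move=> e e0; exists u => //.
  rewrite integral0_eq; last by move=> x _; rewrite subrr expr0n.
  rewrite integral0_eq ?adde0 ?lte_fin ?exprn_gt0// => x _.
  by rewrite subrr enorm_sqr big1// => i _; rewrite mxE expr0n.
split; last exact: test_function_weak_gradient.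
  exact: L2_compact oW cptK (test_function_continuous tu) u0.
move=> i; rewrite (_ : (fun x => _) = partial i u); last first.
  by apply/funext => x; rewrite mxE.
apply: (L2_compact oW cptK (test_function_continuous_partial (i:=i) tu)).
by move=> x Kx; exact: test_function_partial_eq0 cptK u0 tu i x Kx.
Qed.

Lemma not_ae_eq0 W u x : open W -> continuous u -> W x -> u x != 0 ->
  ~ {ae lebesgue_rV n, forall x, W x -> u x = 0}.
Proof.
move=> oW cu Wx ux [N [mN N0 sN]].
pose O := W `&` (u @^-1` [set t | t != 0]).
have oO : open O.
  apply: openI => //; move/continuousP: cu; apply.
  exact: (@open_neq R R^o).
have ON : O `<=` N by move=> y [Wy uy]; apply: sN => /= /(_ Wy) /eqP; exact/negP.
have := lebesgue_rV_open_gt0 oO (conj Wx ux).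
rewrite ltNge -N0 => /negP; apply; apply: le_measure => //; rewrite inE//.
exact: open_measurable_rV.
Qed.

End weights.

Section iterated_exp.
Context {R : realType}.
Implicit Types (y z : R) (i : nat).

Lemma iterlogK i z : iterlog i (iter i expR z) = z.
Proof.
rewrite /iterlog; elim: i z => [//|i IHi] z.
by rewrite iterS [iter i.+1 expR z]iterSr IHi expRK.
Qed.

Lemma iter_expR_ge i z : z <= iter i expR z.
Proof.
elim: i => [//|i IHi]; rewrite iterS (le_trans IHi)//.
by rewrite (le_trans _ (expR_ge1Dx _))// lerDr.
Qed.

Lemma iter_expR_lt i z y : 0 <= z -> z < iterlog i y -> iter i expR z < y.
Proof.
rewrite /iterlog; elim: i z => [//|i IHi] z z0 /= zy.
rewrite -iterS iterSr; apply: IHi; first exact: expR_ge0.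
(* At a nonpositive argument [ln] takes a value that is at most 0, so a logarithm above z >= 0 has a
   positive argument. *)
have y0 : 0 < iter i (@ln R) y.
  rewrite ltNge; apply/negP => y0.
  by move: zy; rewrite ltNge => /negP; apply; rewrite (le_trans _ z0)// ln_le0// (le_trans y0).
by rewrite -(lnK y0) ltr_expR.
Qed.

Lemma iterlog_lt i z y : iter i expR z < y -> z < iterlog i y.
Proof.
rewrite /iterlog; elim: i z => [//|i IHi] z.
rewrite iterSr => /IHi /= H.
by rewrite -ltr_expR lnK// posrE (lt_trans _ H)// expR_gt0.
Qed.

End iterated_exp.

Section trial_test_function.
Context {R : realType} {n : nat}.
Implicit Types (W : set 'rV[R]_n) (u : 'rV[R]_n -> R).

Lemma norm_le_sqnorm (x : 'rV[R]_n) (r : R) : 0 < r -> sqnorm x < r ^+ 2 -> `|x| < r.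
Proof.
move=> r0 xr; apply/mx_norm_ltP => // i.
rewrite -(@ltr_pXn2r _ 2)// ?nnegrE ?normr_ge0 ?(ltW r0)//.
apply: le_lt_trans xr; rewrite real_normK ?num_real// /sqnorm (bigD1 i)//= lerDl.
by apply: sumr_ge0 => j _; rewrite sqr_ge0.
Qed.

Lemma closed_sqnorm_annulus (a b : R) :
  closed [set x : 'rV[R]_n | a <= sqnorm x <= b].
Proof.
rewrite (_ : [set x | _] = (@sqnorm R n) @^-1` [set t | a <= t] `&`
   (@sqnorm R n) @^-1` [set t | t <= b]); last first.
  by apply/seteqP; split=> x /= => [/andP[]|[-> ->]].
apply: closedI; apply: closed_comp => [x _|]; try exact: continuous_sqnorm.
  exact: closed_ge.
exact: closed_le.
Qed.

Lemma compact_sqnorm_annulus (a b : R) :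
  compact [set x : 'rV[R]_n | a <= sqnorm x <= b].
Proof.
apply: bounded_closed_compact; last exact: closed_sqnorm_annulus.
exists (`|b| + 1); split; first exact: num_real.
move=> M bM x /= /andP[_ xb]; apply/ltW.
have M1 : 1 <= M by apply/ltW/(le_lt_trans _ bM); rewrite lerDr.
have M0 : 0 < M by exact: lt_le_trans M1.
apply: norm_le_sqnorm => //; apply: (le_lt_trans xb).
apply: (@lt_le_trans _ _ M); last by rewrite expr2 ler_pMr.
by rewrite (le_lt_trans _ bM)// (le_trans (ler_norm b))// lerDl.
Qed.

(** The bump is nonzero only for 1/delta < L (m+1) < 2/delta, a shell that shrinks to the origin
    with delta. A small delta thus serves two purposes: the support fits into [W], and the error 32
    delta^2 drops below [e]. *)
Lemma trial_test_function W (D : R) k m (e : R) : (0 < n)%N -> open W -> W 0 ->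
  0 < D -> (forall x, W x -> sqnorm x <= D ^+ 2) -> (m <= k.+1)%N -> 0 < e ->
  let rho := D * exp_tower k.+1 in
  exists u, [/\ test_function W u, exists2 x, W x & u x != 0 &
    forall x, W x -> - (u x * \sum_i partial i (partial i u) x) <=
      u x ^+ 2 * ((sqnorm x)^-1 * (((n%:R - 2) / 2) ^+ 2 +
        logsum2 rho m (sqnorm x) / 4 + e * logprod rho m (sqnorm x) ^- 2))].
Proof.
move=> n0 oW W0 D0 WD mk e0 rho.
have rho0 : 0 < rho by rewrite mulr_gt0// (lt_le_trans ltr01)// exp_tower_ge1.
have /nbhs_ballP[r /= r0 rW] := oW _ W0.
have Wr x : sqnorm x < r ^+ 2 -> W x.
  move=> xr; apply: rW; rewrite -ball_normE /ball_/= sub0r normrN.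
  exact: norm_le_sqnorm.
pose r2 := r / 2.
have r20 : 0 < r2 by rewrite divr_gt0.
have r2r : r2 < r by rewrite ltr_pdivrMr// ltr_pMr// ltr1n.
(* The first bound puts the shell inside the radius [r2]; the other two give 32 delta^2 <= 32 delta
   <= e. *)
pose delta := Num.min (r2 / rho) (Num.min 1 (e / 32)).
have d0 : 0 < delta by rewrite /delta !lt_min ltr01 !divr_gt0.
have d1 : delta <= 1 by rewrite /delta !ge_min lexx orbT.
have de : 32 * delta ^+ 2 <= e.
  have : delta <= e / 32 by rewrite /delta !ge_min lexx !orbT.
  rewrite ler_pdivlMr// => H; apply: le_trans H; rewrite mulrC ler_wpM2r//.
  by rewrite expr2 ger_pMr.
have drho : rho / r2 <= delta^-1.
  have : delta <= r2 / rho by rewrite /delta ge_min lexx.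
  by rewrite -lef_pV2 ?posrE ?divr_gt0// invf_div.
clearbody delta.
(* L (m+1) < 2/delta means rho/|x| < E, which fixes the inner radius. L (m+1) > 1/delta makes
   rho/|x| larger than an iterated exponential of 1/delta, hence than 1/delta >= rho/r2, which gives
   the outer radius. *)
pose E := iter m.+1 expR (2 / delta).
have E0 : 0 < E by rewrite (lt_le_trans _ (iter_expR_ge _ _))// divr_gt0.
pose r1 := rho / E.
have r10 : 0 < r1 by rewrite divr_gt0.
pose K := [set x : 'rV[R]_n | r1 ^+ 2 <= sqnorm x <= r2 ^+ 2].
have cptK : compact K by exact: compact_sqnorm_annulus.
have cK : closed K by exact: closed_sqnorm_annulus.
pose U := W `&` [set x : 'rV[R]_n | x != 0].
have oU : open U by apply: openI => //; exact: open_neq.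
have UW : U `<=` W by move=> x [].
have sq0 : sqnorm (0 : 'rV[R]_n) = 0.
  by rewrite /sqnorm big1// => i _; rewrite mxE expr0n.
have inW x : sqnorm x <= r2 ^+ 2 -> W x.
  by move=> xr; apply: Wr; rewrite (le_lt_trans xr)// ltr_pXn2r ?nnegrE ?ltW.
have KU : K `<=` U.
  move=> x /andP[x1 x2]; split; first exact: inW.
  apply/eqP => x0; move: x1; rewrite x0 sq0 leNgt exprn_gt0//.
have lpU (x : 'rV[R]_n) : U x -> logpos rho m (sqnorm x).
  move=> [Wx /= x0]; apply: logposW mk _; apply: logpos_tower => //.
    exact: sqnorm_gt0.
  by rewrite (le_trans (WD _ Wx))// ler_peMl ?sqr_ge0// ler1n.
pose f (x : 'rV[R]_n) : R := @trial R n rho m delta (sqnorm x).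
have f0 (x : 'rV[R]_n) : U x -> ~ K x -> f x = 0.
  move=> Ux nKx; have [_ s0 _] := lpU x Ux.
  have q0 : 0 < Num.sqrt (sqnorm x) by rewrite sqrtr_gt0.
  have q2 : Num.sqrt (sqnorm x) ^+ 2 = sqnorm x by rewrite sqr_sqrtr// ltW.
  apply/eqP/negPn/negP => fx; apply: nKx.
  move: fx; rewrite /f /trial mulf_eq0 negb_or => /andP[_ /bump0_neq0].
  rewrite /phase => /andP[L1 L2].
  have {}L1 : delta^-1 < iterlog m.+1 (rho / Num.sqrt (sqnorm x)).
    by rewrite -[X in X < _]mulr1 ltr_pdivrMl// -subr_gt0 addrC.
  have {}L2 : iterlog m.+1 (rho / Num.sqrt (sqnorm x)) < 2 / delta.
    by rewrite ltr_pdivlMr// mulrC -(ltrD2l (-1)) (lt_le_trans L2)// -subr_ge0; lra.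
  have di0 : 0 <= delta^-1 by rewrite invr_ge0 ltW.
  rewrite /K /= -q2; apply/andP; split.
    rewrite ler_pXn2r ?nnegrE ?(ltW q0) ?(ltW r10)// /r1 ler_pdivrMr//.
    rewrite -ler_pdivrMl// mulrC leNgt; apply/negP => /iterlog_lt.
    by rewrite ltNge (ltW L2).
  rewrite ler_pXn2r ?nnegrE ?(ltW q0) ?(ltW r20)//.
  have := lt_le_trans (le_lt_trans (iter_expR_ge m.+1 _) (iter_expR_lt di0 L1)) (lexx _).
  move=> /(le_lt_trans drho).
  by rewrite ltr_pM2l// ltf_pV2 ?posrE// => /ltW.
have sf : smooth (f \_ U).
  apply: (@smooth_patch _ _ U K (smooth_expr rho m delta)) => //.
  - by move=> g sg x Ux; apply: smooth_expr_continuous sg (lpU x Ux).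
  - move=> g i sg; have [g' [sg' gg']] := smooth_expr_partial i sg.
    by exists g'; split=> // x Ux; exact: gg' (lpU x Ux).
  - exact: smooth_expr_trial.
exists (f \_ U); split.
- exact: test_function_patch oU cptK KU UW f0 sf.
(* The middle of the shell: at |x| = rho/y the phase is 1/2, where the bump is positive. *)
- pose i0 := Ordinal n0; pose y := iter m.+1 expR (3 / 2 / delta).
  have y1 : delta^-1 <= y.
    rewrite (le_trans _ (iter_expR_ge _ _))// ler_peMl ?invr_ge0 ?(ltW d0)//.
    by rewrite ler_pdivlMr// mul1r ler_nat.
  have y0 : 0 < y by rewrite (lt_le_trans _ y1)// invr_gt0.
  pose t0 := rho / y.
  have t00 : 0 < t0 by rewrite divr_gt0.
  pose x := t0 *: (delta_mx 0 i0 : 'rV[R]_n).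
  have sx : sqnorm x = t0 ^+ 2.
    rewrite /sqnorm (bigD1 i0)//= big1 ?addr0 => [|j /negPf ji0].
      by rewrite !mxE !eqxx mulr1.
    by rewrite !mxE ji0 andbF mulr0 expr0n.
  have tr : t0 <= r2.
    rewrite /t0 ler_pdivrMr// -ler_pdivrMl// mulrC (le_trans drho)//.
  have Wx : W x by apply: inW; rewrite sx ler_pXn2r ?nnegrE ?(ltW t00) ?(ltW r20).
  have Ux : U x.
    split=> //=; apply/eqP => x0; move: sx; rewrite x0 sq0 => /esym/eqP.
    by rewrite expf_eq0/= (gt_eqF t00).
  exists x => //; rewrite patchE mem_set// /f /trial sx mulf_neq0//.
    by rewrite /weight expR_eq0.
  have -> : phase rho m delta (t0 ^+ 2) = 2^-1.
    rewrite /phase /ell sqrtr_sqr gtr0_norm// /t0.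
    have -> : rho / (rho / y) = y by field; rewrite (lt0r_neq0 rho0) (lt0r_neq0 y0).
    by rewrite iterlogK; field; rewrite (lt0r_neq0 d0).
  by rewrite /bump0 mulf_neq0// lt0r_neq0// eta_gt0//; lra.
move=> x Wx; have [x0|x0] := eqVneq x 0.
  have -> : (f \_ U) x = 0.
    by rewrite patchE; case: ifP => //; rewrite inE x0 => -[_ /=]; rewrite eqxx.
  by rewrite mul0r oppr0 expr0n mul0r.
have Ux : U x by split.
have D1 i : forall y, is_derive y (delta_mx 0 i) (f \_ U)
    (((fun z => @trial1 R n rho m delta (sqnorm z) * (2 * z 0 i)) \_ U) y) .
  apply: (partial_patch oU cK KU f0 _).2 => z Uz.
  apply: is_derive_chain; first exact: is_derive_sqnorm.
  exact: is_derive_trial (lpU z Uz).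
have f10 i : forall y, U y -> ~ K y -> @trial1 R n rho m delta (sqnorm y) * (2 * y 0 i) = 0.
  apply: (partial_patch oU cK KU f0 _).1 => z Uz.
  apply: is_derive_chain; first exact: is_derive_sqnorm.
  exact: is_derive_trial (lpU z Uz).
have P1 i : partial i (f \_ U) = (fun z => @trial1 R n rho m delta (sqnorm z) * (2 * z 0 i)) \_ U.
  by apply/funext => y; case: (D1 i y).
have P2 i : partial i (partial i (f \_ U)) x =
    @trial2 R n rho m delta (sqnorm x) * (2 * x 0 i) * (2 * x 0 i) +
    @trial1 R n rho m delta (sqnorm x) * 2.
  rewrite P1 /partial.
  have dd z : U z -> is_derive z (delta_mx 0 i)
      (fun z => @trial1 R n rho m delta (sqnorm z) * (2 * z 0 i))
      (@trial2 R n rho m delta (sqnorm z) * (2 * z 0 i) * (2 * z 0 i) +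
       @trial1 R n rho m delta (sqnorm z) * 2).
    move=> Uz.
    have d1' := is_derive_chain (is_derive_sqnorm i z)
      (@is_derive_trial1 R n rho m delta _ (lpU z Uz)).
    have d2' := is_derive_mul (is_derive_cst (2 : R) z (delta_mx 0 i))
      (is_derive_coord i i z).
    apply: (@is_derive_eq _ _ _ _ _ _ _ _ (is_derive_mul d1' d2')).
    by rewrite eqxx /cst/= mul0r add0r mulr1.
  have [_ /(_ x)[_ ->]] := partial_patch oU cK KU (f10 i) dd.
  by rewrite patchE mem_set.
have -> : \sum_i partial i (partial i (f \_ U)) x =
    2 * n%:R * @trial1 R n rho m delta (sqnorm x) +
    4 * sqnorm x * @trial2 R n rho m delta (sqnorm x).
  under eq_bigr do rewrite P2.
  have -> : 2 * n%:R * @trial1 R n rho m delta (sqnorm x) =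
      \sum_(i < n) @trial1 R n rho m delta (sqnorm x) * 2.
    by rewrite sumr_const card_ord -mulr_natl; ring.
  rewrite /sqnorm mulr_sumr mulr_suml -big_split/=.
  by apply: eq_bigr => i _; ring.
rewrite (@trial_laplacian R n rho m delta _ (lpU x Ux)) patchE mem_set// /f /trial.
have [_ s0 _] := lpU x Ux; have p0 := logprod_gt0 (lpU x Ux).
move: (bump0_ge0 (phase rho m delta (sqnorm x))) (bump2_ge (phase rho m delta (sqnorm x))).
move: (bump0 _) (bump2 _) => b0 b2 b00 b2b.
set w := weight _ _ _; set Q := logsum2 _ _ _; set P := logprod _ _ _ in p0 *.
set s := sqnorm x in s0 *; set c := (_ / 2) ^+ 2.
rewrite -subr_ge0.
(* The Hardy potential cancels; what remains has the sign of e b + delta^2 b'', nonnegative since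
   b'' >= - 32 b and 32 delta^2 <= e. *)
have -> : (w * b0) ^+ 2 * (s^-1 * (c + Q / 4 + e * P ^- 2)) -
    - (w * b0 * (- (w / s) * ((c + Q / 4) * b0 - delta ^+ 2 * b2 / P ^+ 2))) =
   w ^+ 2 / s / P ^+ 2 * (b0 * (e * b0 + delta ^+ 2 * b2)).
  by field; rewrite (lt0r_neq0 s0) (lt0r_neq0 p0).
rewrite mulr_ge0//; first by rewrite !divr_ge0 ?sqr_ge0// ltW.
rewrite mulr_ge0//.
have h1 : delta ^+ 2 * (- 32 * b0) <= delta ^+ 2 * b2 by rewrite ler_wpM2l ?sqr_ge0.
have h2 : 32 * delta ^+ 2 * b0 <= e * b0 by rewrite ler_wpM2r.
by lra.
Qed.

End trial_test_function.

(** * The quotient of a trial function, and the value of the infimum *)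

Section hardy_constant.
Context {R : realType} {n : nat}.
Implicit Types (W : set 'rV[R]_n) (u Pot : 'rV[R]_n -> R) (g : 'rV[R]_n -> 'rV[R]_n).

(** The divergence of u grad u is |grad u|^2 plus u times the Laplacian of [u], so the pointwise
    inequality bounds the integral of |grad u|^2. *)
Lemma integral_gradient_le W u Pot : open W -> test_function W u ->
  measurable_fun W (Pot : _ -> measurableTypeR R) ->
  (forall x, W x -> 0 <= Pot x) ->
  (forall x, W x -> - (u x * \sum_i partial i (partial i u) x) <= u x ^+ 2 * Pot x) ->
  (\int[lebesgue_rV n]_(x in W) (enorm (gradient u x) ^+ 2)%:E <=
   \int[lebesgue_rV n]_(x in W) (u x ^+ 2 * Pot x)%:E)%E.
Proof.
move=> oW tu mPot Pot0 H; have [K [cptK KW u0]] := test_functionP tu.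
have cu := test_function_continuous tu.
have cdu i := test_function_continuous_partial (i := i) tu.
have cddu i := test_function_continuous_partial2 (i := i) (j := i) tu.
have mu := measurable_funTS (D:=W) (continuous_measurable_rV cu).
apply: (@le_integral_div _ _ W K (fun i x => u x * partial i u x)
   (fun i x => partial i u x * partial i u x + u x * partial i (partial i u) x)).
- exact: oW.
- exact: cptK.
- exact: KW.
- move=> i x _.
  exact: is_derive_mul (test_function_partial i x tu) (test_function_partial2 i i x tu).
- move=> i x _.
  exact (for_continuousD (for_continuousM (cdu i x) (cdu i x)) (for_continuousM (cu x) (cddu i x))).
- by move=> i x Kx; rewrite u0// mul0r.
- apply: measurable_enorm_sqr => i.
  by have [[_ /(_ i)[]]] := test_function_H10 oW tu.
- by apply: measurable_funM => //; exact: measurable_funX.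
- by move=> x _; rewrite sqr_ge0.
- by move=> x Wx; rewrite mulr_ge0 ?sqr_ge0// Pot0.
- move=> x Wx; rewrite big_split/= -mulr_sumr enorm_sqr.
  have -> : \sum_i gradient u x 0 i ^+ 2 = \sum_i partial i u x * partial i u x.
    by apply: eq_bigr => i _; rewrite mxE expr2.
  by have := H x Wx; lra.
Qed.

Lemma sup_enorm W : open W -> (0 < n)%N -> bounded_set W -> W 0 ->
  let D := sup [set enorm x | x in W] in
  0 < D /\ forall x, W x -> sqnorm x <= D ^+ 2.
Proof.
move=> oW n0 bW W0 D.
have [M [_ /(_ (M + 1))]] := bW; rewrite ltrDl ltr01 => /(_ isT) WM.
have M0 : 0 <= M + 1 by apply: le_trans (WM _ W0); rewrite normr_ge0.
have ub : has_ubound [set enorm x | x in W].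
  (* Boundedness is given for the sup norm; the factor n accounts for the passage to the Euclidean
     one. *)
  exists (Num.sqrt (n%:R * (M + 1) ^+ 2)) => _ [x Wx <-].
  rewrite /enorm ler_sqrt; last by rewrite mulr_ge0 ?sqr_ge0.
  apply: (@le_trans _ _ (\sum_(i < n) (M + 1) ^+ 2)).
    apply: ler_sum => i _; rewrite -real_normK ?num_real// ler_pXn2r ?nnegrE//.
    by rewrite (le_trans (coord_le_norm x i))// WM.
  by rewrite sumr_const card_ord mulr_natl.
have eD x : W x -> enorm x <= D by move=> Wx; apply: ub_le_sup => //; exists x.
have eD0 x : x != 0 -> 0 < enorm x by move=> x0; rewrite sqrtr_gt0 sqnorm_gt0.
have D0 : 0 < D.
  have /nbhs_ballP[r /= r0 rW] := oW _ W0.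
  pose x := (r / 2) *: (delta_mx 0 (Ordinal n0) : 'rV[R]_n).
  have xi : x 0 (Ordinal n0) = r / 2 by rewrite !mxE !eqxx mulr1.
  apply: (@lt_le_trans _ _ (enorm x)).
    apply: eD0; apply/eqP => x0; move: xi; rewrite x0 mxE => /esym/eqP.
    by rewrite gt_eqF// divr_gt0.
  apply: eD; apply: rW; rewrite -ball_normE /ball_/= sub0r normrN.
  apply/mx_norm_ltP => // i; rewrite !mxE eqxx/=; case: (_ == _).
    by rewrite mulr1 gtr0_norm ?divr_gt0// ltr_pdivrMr// ltr_pMr// ltr1n.
  by rewrite mulr0 normr0.
split=> // x Wx; have -> : sqnorm x = enorm x ^+ 2 by rewrite enorm_sqr.
rewrite ler_pXn2r ?nnegrE ?(ltW D0) ?eD//.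
exact: sqrtr_ge0.
Qed.

End hardy_constant.

Theorem mainTheorem6 (R : realType) (n : nat) (W : set 'rV[R]_n) (k m : nat)
    (rho : R) :
  (3 <= n)%N -> open W -> connected W -> bounded_set W -> W 0 ->
  (1 <= k)%N ->
  rho = sup [set enorm x | x in W] * exp_tower k ->
  (1 <= m <= k)%N ->
  (4^-1)%:E =
  ereal_inf [set q | exists u g,
    [/\ sobolevH10 W u g,
        ~ {ae lebesgue_rV n, forall x, W x -> u x = 0}
      & q = hardy_quotient W rho m u g]].
Proof.
move=> n3 oW _ bW W0; case: k => // k _ rhoE /andP[m1 mk].
have n0 : (0 < n)%N by apply: leq_trans n3.
have n2 : (2 <= n)%N by apply: leq_trans n3.
have [D0 WD] := sup_enorm oW n0 bW W0.
set D := sup _ in D0 WD rhoE.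
have mW : measurable W by exact: open_measurable_rV.
pose c : R := ((n%:R - 2) / 2) ^+ 2.
have c0 : 0 < c.
  rewrite exprn_gt0// divr_gt0// subr_gt0 ltr_nat//.
have lp x : W x -> x != 0 -> logpos rho m (sqnorm x).
  move=> Wx x0; rewrite rhoE; apply: logposW mk _; apply: logpos_tower => //.
    exact: sqnorm_gt0.
  by rewrite (le_trans (WD _ Wx))// ler_peMl ?sqr_ge0// ler1n.
(* The quotient involves differences and a division of extended reals. The improved inequality
   bounds every subtracted term and the denominator by a multiple of the finite Dirichlet integral,
   so from here on the computation takes place in the reals. *)
have main u g : sobolevH10 W u g -> ~ {ae lebesgue_rV n, forall x, W x -> u x = 0} ->
  exists a b d G : R, [/\ 0 < d /\ c * a + 4^-1 * (b + d) <= G,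
    (\int[lebesgue_rV n]_(x in W) (u x ^+ 2 / enorm x ^+ 2)%:E = a%:E)%E,
    (\sum_(1 <= j < m) log_hardy W rho j u = b%:E)%E,
    log_hardy W rho m u = d%:E &
    (\int[lebesgue_rV n]_(x in W) (enorm (g x) ^+ 2)%:E = G%:E)%E].
  move=> Hug u0.
  have mu : measurable_fun W u by case: Hug => -[[]].
  have := hardy_H10 n2 oW D0 WD mk Hug; rewrite -rhoE => Hle.
  have Goo : (\int[lebesgue_rV n]_(x in W) (enorm (g x) ^+ 2)%:E < +oo)%E.
    by apply: L2_enorm => //; case: Hug => -[].
  have sp := log_hardy_split rho m mW mu (ltW c0) (lexx 0).
  rewrite mul0e adde0 in sp.
  have E : (\int[lebesgue_rV n]_(x in W) (u x ^+ 2 * ((sqnorm x)^-1 *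
      (c + logsum2 rho m (sqnorm x) / 4)))%:E =
    \int[lebesgue_rV n]_(x in W) (u x ^+ 2 * ((sqnorm x)^-1 *
      (c + logsum2 rho m (sqnorm x) / 4 + 0 * logprod rho m (sqnorm x) ^- 2)))%:E)%E.
    by apply: eq_integral => x _; rewrite mul0r addr0.
  (* The term of index [m] is split off the sum: it is 1/4 times the denominator of the quotient. *)
  move: Hle; rewrite -/c E sp big_nat_recr//=.
  have d0 : (0 < log_hardy W rho m u)%E.
    by apply: log_hardy_gt0 => // x Wx x0; apply: lt0r_neq0; exact: logprod_gt0 (lp x Wx x0).
  have a0 : (0 <= \int[lebesgue_rV n]_(x in W) (u x ^+ 2 / enorm x ^+ 2)%:E)%E.
    by apply: integral_ge0 => x _; rewrite lee_fin divr_ge0 ?sqr_ge0.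
  have b0 : (0 <= \sum_(1 <= j < m) log_hardy W rho j u)%E.
    apply: sume_ge0 => j _; rewrite log_hardyE; apply: integral_ge0 => x _.
    by rewrite lee_fin mulr_ge0 ?sqr_ge0 ?hweight_ge0.
  have G0 : (0 <= \int[lebesgue_rV n]_(x in W) (enorm (g x) ^+ 2)%:E)%E.
    by apply: integral_ge0 => x _; rewrite lee_fin sqr_ge0.
  (* A finite sum of nonnegative terms has finite terms. The coefficient must be positive, since 0
     times infinity is 0; for the Hardy term this is where n >= 3 gives c > 0. *)
  have fin (r : R) (X Y : \bar R) : 0 < r -> (0 <= X)%E -> (0 <= Y)%E ->
      (r%:E * X + Y < +oo)%E -> X \is a fin_num /\ Y \is a fin_num.
    move=> r0 X0 Y0; move: X Y X0 Y0 => [x| |] [y| |]//= _ _.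
      by rewrite gt0_muley ?lte_fin.
    by rewrite gt0_muley ?lte_fin.
  move=> H; have := le_lt_trans H Goo.
  have bd0 := adde_ge0 b0 (ltW d0).
  have v0 : 0 < 4^-1 :> R by rewrite invr_gt0.
  case/(fin _ _ _ c0 a0 (mule_ge0 _ bd0)); first by rewrite lee_fin ltW.
  move=> afin /fin_numPlt/andP[_].
  rewrite -[X in (X < _)%E]adde0 => /(fin _ _ _ v0 bd0 (lexx 0%E))[+ _].
  rewrite fin_numD => /andP[bfin dfin].
  have Gfin : (\int[lebesgue_rV n]_(x in W) (enorm (g x) ^+ 2)%:E)%E \is a fin_num.
    by rewrite ge0_fin_numE.
  have fe (x : \bar R) : x \is a fin_num -> exists r, x = r%:E.
    by case: x => // r _; exists r.
  have [a Ea] := fe _ afin; have [b Eb] := fe _ bfin.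
  have [d Ed] := fe _ dfin; have [G EG] := fe _ Gfin.
  exists a, b, d, G; split=> //; split; first by rewrite -lte_fin -Ed.
  by move: H; rewrite Ea Eb Ed EG.
apply/esym/eqP; rewrite eq_le; apply/andP; split; last first.
  apply: le_ereal_inf_tmp => _ [u [g [Hug u0 ->]]].
  have [a [b [d [G [[d0 H] Ea Eb Ed EG]]]]] := main u g Hug u0.
  rewrite /hardy_quotient Ea Eb Ed EG -/c.
  rewrite inver gt_eqF// [X in (_ <= X)%E](_ : _ = ((G - c * a - 4^-1 * b) / d)%:E)//.
  rewrite lee_fin.
  by rewrite ler_pdivlMr//; lra.
apply/lee_addgt0Pr => e e0.
have [u [tu [x Wx ux] Hu]] := trial_test_function n0 oW W0 D0 WD mk e0.
rewrite -rhoE -/c in Hu.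
have u0 := not_ae_eq0 oW (test_function_continuous tu) Wx ux.
have Hug := test_function_H10 oW tu.
apply: (@le_trans _ _ (hardy_quotient W rho m u (gradient u))).
  by apply: ereal_inf_lbound; exists u, (gradient u).
have [a [b [d [G [[d0 _] Ea Eb Ed EG]]]]] := main u _ Hug u0.
have mu : measurable_fun W u by case: Hug => -[[]].
have sp := log_hardy_split rho m mW mu (ltW c0) (ltW e0).
have : (G%:E <= c%:E * a%:E + (4^-1)%:E * (b%:E + d%:E) + e%:E * d%:E)%E.
  move: sp; rewrite big_nat_recr//= Ea Eb Ed => <-; rewrite -EG.
  apply: integral_gradient_le => //.
    apply: measurable_funTS.
    rewrite (_ : (fun y => _) = fun y : 'rV[R]_n => c * hweight rho 0 y +
        4^-1 * \sum_(1 <= j < m.+1) hweight rho j y + e * hweight rho m y); last first.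
      apply/funext => y; rewrite /hweight -mulr_sumr -/(logsum2 rho m (sqnorm y)).
      by rewrite logprod0 expr1n invr1; ring.
    have mh := @measurable_hweight R n rho.
    have mM (r : R) (f : 'rV[R]_n -> R) :
        measurable_fun [set: 'rV[R]_n] (f : _ -> measurableTypeR R) ->
        measurable_fun [set: 'rV[R]_n] (fun y => r * f y : measurableTypeR R).
      by move=> mf; apply: measurable_funM => //; exact: measurable_cst.
    apply: measurable_funD; last exact: mM (mh m).
    apply: measurable_funD; first exact: mM (mh 0%N).
    by apply: mM; apply: measurable_sum => j; exact: mh.
  move=> y _; rewrite mulr_ge0 ?invr_ge0 ?sqnorm_ge0//.
  by rewrite !addr_ge0 ?(ltW c0) ?divr_ge0 ?logsum2_ge0// ?sqr_ge0// ltW.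
rewrite [X in (_ <= X)%E](_ : _ = (c * a + 4^-1 * (b + d) + e * d)%:E)// lee_fin => H.
rewrite /hardy_quotient Ea Eb Ed EG -/c.
rewrite inver gt_eqF// [X in (X <= _)%E](_ : _ = ((G - c * a - 4^-1 * b) / d)%:E)//.
rewrite -EFinD lee_fin.
by rewrite ler_pdivrMr//; lra.
Qed.
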